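(* Let $S$ be a weak-twist local energy, and let $p\ge1$ and $q$ be integers. Let $x^-,x^+\in\mathcal{M}_{p,q}$ with $x^-\ll x^+$ be such that there is no $y\in\mathcal{M}_{p,q}$ with $x^-\ll y\ll x^+$. Then there exist sequences $x\in\mathcal{BM}^+_{q/p}\setminus\mathcal{M}_{p,q}$ and $\bar x\in\mathcal{BM}^-_{q/p}\setminus\mathcal{M}_{p,q}$ such that $$\lim_{n\to\infty}\tau_{p,q}^n x=x^+=\lim_{n\to-\infty}\tau_{p,q}^n\bar x\qquad\text{and}\qquad \lim_{n\to-\infty}\tau_{p,q}^n x=x^-=\lim_{n\to\infty}\tau_{p,q}^n\bar x,$$ where the limits are pointwise.
   Context: Let $r\ge1$ be an integer and $K,\lambda>0$. A weak-twist local energy is a function $S\in C^2(\mathbb{R}^{r+1})$ of the form $S(\xi_1,\dots,\xi_{r+1})=\sum_{j=1}^r f_j(\xi_1,\xi_{j+1})$ with $f_j\in C^2(\mathbb{R}^2)$ such that for each $1\le j\le r$: (1) $f_j(\nu+1,\mu+1)=f_j(\nu,\mu)$; (2) $\|\partial_{i,k}f_j\|_{\sup}\le K/r$ for $i,k\in\{1,2\}$; (3) $f_j(\nu,\mu)\to\infty$ as $|\nu-\mu|\to\infty$; and, writing $S_i(x):=S(x_i,\dots,x_{i+r})$ for $x\in\mathbb{R}^{\mathbb{Z}}$ and $\partial_{j,k}$ for second derivatives with respect to $x_j,x_k$, (4) (weak twist) $\partial_{j,k}S_i\le 0$ for all $j\ne k$ and $\partial_{i,i+1}S_i<-\lambda<0$,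 for all $i\in\mathbb{Z}$. For integers $i_0\le i_1$ let $B=[i_0-r,i_1]\subset\mathbb{Z}$, $\mathring{B}=[i_0,i_1]$ and $W_B(x):=\sum_{i\in B}S_i(x)$. A sequence $x\in\mathbb{R}^{\mathbb{Z}}$ is a global minimizer if $W_B(x)\le W_B(x+v)$ for every such $B$ and every $v$ supported in $\mathring{B}$. $\mathcal{M}$ is the set of global minimizers. Order: $x\le y$ means $x_i\le y_i$ for all $i$; $x\ll y$ means $x_i<y_i$ for all $i$. Translations: $(\tau_{k,l}x)_i:=x_{i-k}+l$ for $k,l\in\mathbb{Z}$. A sequence $x$ is Birkhoff if for all $(k,l)\in\mathbb{Z}^2$ either $\tau_{k,l}x\le x$ or $\tau_{k,l}x\ge x$. Every Birkhoff sequence has a rotation number $\rho(x)=\lim_{n\to\pm\infty}x_n/n$; $\mathcal{B}_\nu$ is the set of Birkhoff sequences with rotation number $\nu$. Define $\mathcal{BM}^+_{q/p}:=\{x\in\mathcal{M}\cap\mathcal{B}_{q/p}\mid \tau_{p,q}x\ge x\}$ and $\mathcal{BM}^-_{q/p}:=\{x\in\mathcal{M}\cap\mathcal{B}_{q/p}\mid \tau_{p,q}x\le x\}$. $\mathcal{M}_{p,q}$ is the set of $p$-$q$-minimizers: the minimizers of $W_{p,q}:=\sum_{i=1}^p S_i$ on $\mathbb{X}_{p,q}:=\{x\in\mathbb{R}^{\mathbb{Z}}\mid\tau_{p,q}x=x\}$ (it is known that $\mathcal{M}_{p,q}=\mathcal{M}\cap\mathbb{X}_{p,q}$ and that its elements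 are Birkhoff). *)

(* Defs.v *)
From HB Require Import structures.
From mathcomp Require Import all_boot all_order all_algebra.
From mathcomp Require Import all_classical all_reals all_analysis.
Set Implicit Arguments.
Unset Strict Implicit.
Unset Printing Implicit Defensive.
Import Order.TTheory GRing.Theory Num.Theory.
Import numFieldNormedType.Exports.
Local Open Scope classical_set_scope.
Local Open Scope ring_scope.

Definition partial (R : realType) (n : nat) (i : 'I_n.+1)
    (g : 'rV[R]_n.+1 -> R) : 'rV[R]_n.+1 -> R :=
  'D_(delta_mx ord0 i) g.

(* All partial derivatives of order 0, 1 and 2 exist and are continuous. *)
Definition C2 (R : realType) (n : nat) (g : 'rV[R]_n.+1 -> R) : Prop :=
  [/\ continuous g,
      forall i x, derivable g x (delta_mx ord0 i),
      forall i, continuous (partial i g),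
      forall i k x, derivable (partial k g) x (delta_mx ord0 i) &
      forall i k, continuous (partial i (partial k g))].

Definition pt2 (R : realType) (nu mu : R) : 'rV[R]_2 :=
  \row_(k < 2) if k == ord0 then nu else mu.

Definition zseq (R : realType) : Type := int -> R.

Definition update (R : realType) (x : zseq R) (j : int) (t : R) :
    zseq R :=
  fun k => if k == j then t else x k.

(* Partial derivative of a function on R^Z with respect to the variable x_j.
   R^Z carries no norm, so 'D_v is not available there. *)
Definition partial_seq (R : realType) (j : int) (F : zseq R -> R)
    (x : zseq R) : R :=
  derive1 (fun t : R => F (update x j t)) (x j).

(* The local energy S_i(x) = S(x_i, ..., x_{i+r}). *)
Definition shiftS (R : realType) (r : nat) (S : 'rV[R]_r.+1 -> R) (i : int)
    (x : zseq R) : R :=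
  S (\row_(k < r.+1) x (i + (k : nat)%:Z)).

Definition weak_twist_energy (R : realType) (r : nat) (K lambda : R)
    (S : 'rV[R]_r.+1 -> R) : Prop :=
  C2 S /\
  (exists f : 'I_r -> 'rV[R]_2 -> R,
    (forall xi : 'rV[R]_r.+1,
       S xi = \sum_(j < r) f j (pt2 (xi ord0 ord0) (xi ord0 (lift ord0 j)))) /\
    (forall j : 'I_r,
      [/\ C2 (f j),
          forall nu mu : R, f j (pt2 (nu + 1) (mu + 1)) = f j (pt2 nu mu),
          forall (i k : 'I_2) (xi : 'rV[R]_2),
            `|partial i (partial k (f j)) xi| <= K / r%:R &
          forall A : R, exists M : R, forall nu mu : R,
            M < `|nu - mu| -> A < f j (pt2 nu mu)])) /\
  (forall (i j k : int) (x : zseq R), j != k ->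
     partial_seq j (partial_seq k (shiftS S i)) x <= 0) /\
  (forall (i : int) (x : zseq R),
     partial_seq i (partial_seq (i + 1) (shiftS S i)) x < - lambda).

(* The sum of S_i over the integers a <= i <= b; only used when a <= b. *)
Definition energy (R : realType) (r : nat) (S : 'rV[R]_r.+1 -> R) (a b : int)
    (x : zseq R) : R :=
  \sum_(0 <= k < `|(b - a)%R|%N.+1) shiftS S (a + k%:Z) x.

Definition global_minimizer (R : realType) (r : nat) (S : 'rV[R]_r.+1 -> R)
    (x : zseq R) : Prop :=
  forall (i0 i1 : int) (v : zseq R), i0 <= i1 ->
    (forall i : int, ~~ (i0 <= i <= i1) -> v i = 0) ->
    energy S (i0 - r%:Z) i1 x <= energy S (i0 - r%:Z) i1 (fun i => x i + v i).

Definition le_seq (R : realType) (x y : zseq R) : Prop :=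
  forall i : int, x i <= y i.

Definition lt_seq (R : realType) (x y : zseq R) : Prop :=
  forall i : int, x i < y i.

Definition tau (R : realType) (k l : int) (x : zseq R) : zseq R :=
  fun i => x (i - k) + l%:~R.

Lemma tau_add (R : realType) (k l k' l' : int) (x : zseq R) :
  tau k l (tau k' l' x) = tau (k + k') (l + l') x.
Proof.
apply/funext => i; by rewrite /tau opprD addrA (addrC l) intrD [RHS]addrA.
Qed.

Lemma tau0 (R : realType) (x : zseq R) : tau 0 0 x = x.
Proof. by apply/funext => i; rewrite /tau subr0 mulr0z addr0. Qed.

(* The n-th power of the bijection tau_{k,l}, for n of any sign: by tau_add
   and tau0, the inverse of tau_{k,l} is tau_{-k,-l}. *)
Definition tau_pow (R : realType) (k l n : int) (x : zseq R) :
    zseq R :=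
  match n with
  | Posz m => iter m (tau k l) x
  | Negz m => iter m.+1 (tau (- k) (- l)) x
  end.

Definition birkhoff (R : realType) (x : zseq R) : Prop :=
  forall k l : int, le_seq (tau k l x) x \/ le_seq x (tau k l x).

Definition has_rotation_number (R : realType) (x : zseq R) (nu : R) :
    Prop :=
  ((fun n : nat => x n%:Z / n%:R) @ \oo --> nu) /\
  ((fun n : nat => x (- n%:Z) / (- n%:R)) @ \oo --> nu).

Definition birkhoff_rot (R : realType) (nu : R) : set (zseq R) :=
  [set x | birkhoff x /\ has_rotation_number x nu].

Definition BMplus (R : realType) (r : nat) (S : 'rV[R]_r.+1 -> R)
    (p : nat) (q : int) : set (zseq R) :=
  [set x | [/\ global_minimizer S x, birkhoff_rot (q%:~R / p%:R) x &
               le_seq x (tau p%:Z q x)]].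

Definition BMminus (R : realType) (r : nat) (S : 'rV[R]_r.+1 -> R)
    (p : nat) (q : int) : set (zseq R) :=
  [set x | [/\ global_minimizer S x, birkhoff_rot (q%:~R / p%:R) x &
               le_seq (tau p%:Z q x) x]].

Definition periodic_seqs (R : realType) (p : nat) (q : int) :
    set (zseq R) :=
  [set x | tau p%:Z q x = x].

Definition periodic_energy (R : realType) (r : nat) (S : 'rV[R]_r.+1 -> R)
    (p : nat) (x : zseq R) : R :=
  \sum_(1 <= i < p.+1) shiftS S i%:Z x.

Definition pq_minimizers (R : realType) (r : nat) (S : 'rV[R]_r.+1 -> R)
    (p : nat) (q : int) : set (zseq R) :=
  [set x | periodic_seqs p q x /\
           forall y, periodic_seqs p q y ->
             periodic_energy S p x <= periodic_energy S p y].

Definition lim_pinfty (R : realType) (u : int -> zseq R)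
    (y : zseq R) : Prop :=
  forall i : int, (fun n : nat => u n%:Z i) @ \oo --> y i.

Definition lim_minfty (R : realType) (u : int -> zseq R)
    (y : zseq R) : Prop :=
  forall i : int, (fun n : nat => u (- n%:Z) i) @ \oo --> y i.

(* Main.v *)
Require Import Defs.
From HB Require Import structures.
From mathcomp Require Import all_boot all_order all_algebra.
From mathcomp Require Import all_classical all_reals all_analysis.
From mathcomp Require Import zify ring lra.
Import Order.TTheory GRing.Theory Num.Theory.
Import numFieldNormedType.Exports.
Local Open Scope classical_set_scope.
Local Open Scope ring_scope.

(** The weak twist condition says that every local energy is submodular: passing
    from two sequences to their pointwise minimum and maximum never raises the
    total energy.  Its strict part, for nearest neighbours, gives Aubry's
    touching principle: two ordered global minimizers that meet at one site
    coincide.  The record [lattice_energy] isolates these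
    properties; they are all that the construction uses, and they are stable
    under [x |-> -x], so only the connection descending under the translation
    [tau p q] has to be built ([descending_heteroclinic]); the other one is its
    mirror image ([ascending_heteroclinic]).

    Periodic minimizers are global minimizers ([pq_minimizer_global]): in a
    compact box of np-nq-periodic sequences the least minimizer lies below its
    translate by [tau p q], and n translations bring it back to itself, so it is
    p-q-periodic.  Submodularity and touching then show that a p-q-minimizer lies
    below [lo] or above [hi], the two ends of the gap ([gap_total]).

    A transition on a window is a sequence between [lo] and [hi] that equals [lo]
    to the left of the window and [hi] to its right.  Transitions on a given
    window form a compact lattice, so one of minimal energy that is least in the
    pointwise order exists; moving the window to the right lowers it
    ([least_transition_le]).  Hence every translation that shifts to the right
    and fixes [lo] and [hi] lowers it too, and this closed condition is what
    makes the limit Birkhoff.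

    Minimal transitions on windows of n periods, translated so that they cross
    the middle of the gap near the site 0, have a cluster point x
    for n going to infinity.  The point is that x is a global minimizer even
    though one end of the windows might stay at bounded distance: if a
    modification of x on a bounded window gained a fixed amount of energy, the
    same modification would gain almost as much for infinitely many of the
    transitions, at the cost of a slightly larger window; but the renormalized
    energies of minimal transitions approach their infimum over all windows,
    which is finite ([renormalized_energy_bound]), so no fixed gain is possible
    ([cluster_global_minimizer]).

    The iterates of x under [tau p q] are monotone, and their limits in both
    directions are periodic global minimizers in the strip, hence [lo] or [hi].
    The crossing at the site 0 decides which, and keeps x from being periodic. *)

Set Implicit Arguments.
Unset Strict Implicit.

(** * Sequences and energies of windows *)

Definition seq_min (R : realType) (x y : zseq R) : zseq R :=
  fun i => Num.min (x i) (y i).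

Definition seq_max (R : realType) (x y : zseq R) : zseq R :=
  fun i => Num.max (x i) (y i).

(** The sum starts at [c] and has [n] terms, so it involves the sites from [c]
    to [c + n + r - 1]. *)
Definition window_energy (R : realType) (r : nat) (S : 'rV[R]_r.+1 -> R)
    (c : int) (n : nat) (x : zseq R) : R :=
  \sum_(0 <= k < n) shiftS S (c + k%:Z) x.

Definition splice (R : realType) (a b : int) (x y : zseq R) : zseq R :=
  fun i => if a <= i < b then y i else x i.

Section Translations.
Variable R : realType.
Implicit Types x y : zseq R.

Lemma tauK k l x : tau k l (tau (- k) (- l) x) = x.
Proof. by rewrite tau_add !subrr tau0. Qed.

Lemma tauNK k l x : tau (- k) (- l) (tau k l x) = x.
Proof. by rewrite tau_add !addNr tau0. Qed.

Lemma tau_iter k l m x : iter m (tau k l) x = tau (k * m%:Z) (l * m%:Z) x.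
Proof.
elim: m => [|m IH]; first by rewrite !mulr0 tau0.
rewrite iterS IH tau_add.
have mulS (n : int) : n + n * m%:Z = n * m.+1%:Z by lia.
by rewrite !mulS.
Qed.

Lemma tau_powE k l n x : tau_pow k l n x = tau (k * n) (l * n) x.
Proof.
case: n => m; rewrite /tau_pow tau_iter //.
by rewrite NegzE !mulrN !mulNr.
Qed.

Lemma tau_fixV k l x : tau k l x = x -> tau (- k) (- l) x = x.
Proof. by move=> h; rewrite -{1}h tauNK. Qed.

Lemma tau_fixM k l x (n : int) :
  tau k l x = x -> tau (k * n) (l * n) x = x.
Proof.
have pos k' l' m : tau k' l' x = x -> tau (k' * m%:Z) (l' * m%:Z) x = x.
  by move=> h; rewrite -tau_iter; elim: m => //= m ->.
case: n => m h; first exact: pos.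
by rewrite NegzE !mulrN -!mulNr; apply: pos; exact: tau_fixV.
Qed.

Lemma le_tau k l x y : le_seq x y -> le_seq (tau k l x) (tau k l y).
Proof. by move=> h i; rewrite /tau lerD2r; exact: h. Qed.

Lemma le_tauP k l x y : le_seq (tau k l x) y <-> le_seq x (tau (- k) (- l) y).
Proof.
split=> h; first by rewrite -[x](tauNK k l); exact: le_tau.
by rewrite -[y](tauK k l); exact: le_tau.
Qed.

Lemma le_seq_trans x y z : le_seq x y -> le_seq y z -> le_seq x z.
Proof. by move=> h g i; exact: le_trans (h i) (g i). Qed.

Lemma le_seq_anti x y : le_seq x y -> le_seq y x -> x = y.
Proof.
by move=> h g; apply/funext => i; apply/eqP; rewrite eq_le h g.
Qed.

Lemma tau_min k l x y :
  tau k l (seq_min x y) = seq_min (tau k l x) (tau k l y).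
Proof. by apply/funext => i; rewrite /tau /seq_min addr_minl. Qed.

Lemma tau_max k l x y :
  tau k l (seq_max x y) = seq_max (tau k l x) (tau k l y).
Proof. by apply/funext => i; rewrite /tau /seq_max addr_maxl. Qed.

Lemma seq_min_lel x y : le_seq (seq_min x y) x.
Proof. by move=> i; rewrite /seq_min ge_min lexx. Qed.

Lemma seq_min_ler x y : le_seq (seq_min x y) y.
Proof. by move=> i; rewrite /seq_min ge_min lexx orbT. Qed.

Lemma seq_max_gel x y : le_seq x (seq_max x y).
Proof. by move=> i; rewrite /seq_max le_max lexx. Qed.

Lemma seq_max_ger x y : le_seq y (seq_max x y).
Proof. by move=> i; rewrite /seq_max le_max lexx orbT. Qed.

Lemma le_seq_min x y z : le_seq z x -> le_seq z y -> le_seq z (seq_min x y).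
Proof. by move=> h g i; rewrite /seq_min le_min h g. Qed.

Lemma le_seq_max x y z : le_seq x z -> le_seq y z -> le_seq (seq_max x y) z.
Proof. by move=> h g i; rewrite /seq_max ge_max h g. Qed.

End Translations.

Section WindowEnergy.
Variables (R : realType) (r : nat) (S : 'rV[R]_r.+1 -> R).
Implicit Types (x y z : zseq R) (c : int) (n m : nat).
Local Notation en := (window_energy S).

Lemma shiftS_local i x y :
  (forall j : int, i <= j <= i + r%:Z -> x j = y j) ->
  shiftS S i x = shiftS S i y.
Proof.
move=> h; rewrite /shiftS; congr S; apply/rowP => k; rewrite !mxE.
by apply: h; have := ltn_ord k; lia.
Qed.

Lemma en_local c n x y :
  (forall j : int, c <= j < c + n%:Z + r%:Z -> x j = y j) ->
  en c n x = en c n y.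
Proof.
move=> h; apply: eq_big_nat => k kn; apply: shiftS_local => j ij.
by apply: h; lia.
Qed.

Lemma en_cat c n m x : en c (n + m) x = en c n x + en (c + n%:Z) m x.
Proof.
rewrite /window_energy (@big_cat_nat _ _ _ n) //=; last by rewrite leq_addr.
congr (_ + _); rewrite -{1}[n]add0n big_addn addKn.
by apply: eq_bigr => k _; congr (shiftS S _ x); lia.
Qed.

(** A change of the sequence at the sites i with c + r <= i < c + n is seen
    only by the local energies of the window, so the gain does not depend on
    the window that contains it. *)
Lemma en_widen c n c' n' x y :
  c' <= c -> c + n%:Z <= c' + n'%:Z ->
  (forall i : int, (i < c + r%:Z) || (c + n%:Z <= i) -> x i = y i) ->
  en c' n' y - en c' n' x = en c n y - en c n x.
Proof.
move=> hc hn h.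
have -> : n' = (`|(c - c')%R| + (n + `|(c' + n'%:Z - (c + n%:Z))%R|))%N by lia.
have hc' : c' + `|(c - c')%R|%N%:Z = c by lia.
rewrite !en_cat hc'.
rewrite [en c' _ y](@en_local _ _ y x) => [|j hj]; last first.
  by apply/esym/h; lia.
rewrite [en (c + _) _ y](@en_local _ _ y x) => [|j hj]; last first.
  by apply/esym/h; lia.
ring.
Qed.

(** The formulation used below: the window determines its free sites, those i
    with c + r <= i < c + n, at which a change is seen by no local energy
    outside the window. *)
Lemma global_minimizerP x : global_minimizer S x <->
  forall c n y, (forall i : int, (i < c + r%:Z) || (c + n%:Z <= i) -> x i = y i) ->
    en c n x <= en c n y.
Proof.
split=> [gx c n y h|h i0 i1 v i01 hv].
  have [nr|rn] := leqP n r.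
    suff -> : x = y by [].
    by apply/funext => i; apply: h; lia.
  have := gx (c + r%:Z) (c + n%:Z - 1) (fun i => y i - x i).
  have -> : (fun i => x i + (y i - x i)) = y.
    by apply/funext => i; rewrite addrC subrK.
  have -> : energy S (c + r%:Z - r%:Z) (c + n%:Z - 1) = en c n.
    apply/funext => z; rewrite /energy addrK; congr (window_energy S _ _ z).
    by lia.
  apply; first by lia.
  by move=> i hi; rewrite h ?subrr //; lia.
apply: (h _ _ (fun i => x i + v i)) => i hi.
by rewrite hv ?addr0 //; lia.
Qed.

End WindowEnergy.

(** * Lattice energies and the pointwise topology *)

(** What remains of the weak twist condition in the construction.  The
    touching property is Aubry's lemma, stated for global minimizers so that
    it is preserved by the reflection [x |-> -x]. *)
Record lattice_energy (R : realType) (r : nat) (S : 'rV[R]_r.+1 -> R) :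
    Prop := LatticeEnergy {
  lattice_energy_continuous : continuous S;
  lattice_energy_periodic : forall xi, S (xi + const_mx 1) = S xi;
  lattice_energy_submodular : forall (i : int) (x y : zseq R),
    shiftS S i (seq_min x y) + shiftS S i (seq_max x y) <=
    shiftS S i x + shiftS S i y;
  lattice_energy_touching : forall (x y : zseq R) (i : int),
    global_minimizer S x -> global_minimizer S y ->
    le_seq x y -> x i = y i -> x = y }.

Section PointwiseTopology.
Variable R : realType.
Local Notation X := {ptws int -> R}.

Lemma continuous_coord (i : int) : continuous (fun x : X => x i).
Proof. exact: (@proj_continuous int (fun=> R) i). Qed.

Lemma continuous_add_fun (T : topologicalType) (f g : T -> R) :
  continuous f -> continuous g -> continuous (fun x => f x + g x).
Proof. by move=> cf cg x; apply: cvgD; [exact: cf | exact: cg]. Qed.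

Lemma continuous_sub_fun (T : topologicalType) (f g : T -> R) :
  continuous f -> continuous g -> continuous (fun x => f x - g x).
Proof. by move=> cf cg x; apply: cvgB; [exact: cf | exact: cg]. Qed.

Lemma closed_le_fun (T : topologicalType) (f g : T -> R) :
  continuous f -> continuous g -> closed [set x | f x <= g x].
Proof.
move=> cf cg.
have -> : [set x | f x <= g x] = (fun x => g x - f x) @^-1` [set t | 0 <= t].
  by apply/seteqP; split=> x /=; rewrite subr_ge0.
apply: closed_comp => [x _|]; last exact: closed_ge.
exact: continuous_sub_fun.
Qed.

Lemma cvg_pointwise (F : set_system X) (FF : Filter F) (z : X) :
  (forall i : int, (fun x : X => x i) @ F --> z i) -> F --> z.
Proof.
move=> h; apply/cvg_sup => i; apply/cvg_image.
  by apply/seteqP; split=> // t _; exists (fun=> t).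
move=> A /= hA; have := h i _ hA; rewrite /= => hF.
exists ((fun x : X => x i) @^-1` A) => //.
by apply/seteqP; split=> [_ [x Ax <-]//|t At]; exists (fun=> t).
Qed.

Lemma continuous_pointwise (T : topologicalType) (f : T -> X) :
  (forall i : int, continuous (fun t => f t i)) -> continuous f.
Proof. by move=> h t; apply: cvg_pointwise => i; exact: h. Qed.

Lemma continuous_shiftS r (S : 'rV[R]_r.+1 -> R) (i : int) :
  continuous S -> continuous (shiftS S i : X -> R).
Proof.
move=> cS x.
pose g (y : X) : 'rV[R]_r.+1 := \row_(k < r.+1) y (i + (k : nat)%:Z).
apply: (@continuous_comp X 'rV[R]_r.+1 R g S); last exact: cS.
move=> A [E hE sE].
have near k : nbhs x [set y : X | E ord0 k (y (i + (k : nat)%:Z))].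
  have := hE ord0 k; rewrite /g mxE => hk.
  exact: (@continuous_coord (i + (k : nat)%:Z) x _ hk).
have nearall := @filter_forall X _ _ _ (nbhs_filter x) near.
change (nbhs x (g @^-1` A)).
refine (@filterS X (nbhs x) _ _ _ _ nearall) => y hy.
refine (sE (g y) _) => j k.
by rewrite ord1 mxE; exact: hy.
Qed.

Lemma continuous_splice (a b : int) (y : X) :
  continuous (fun x : X => splice a b x y : X).
Proof.
apply: continuous_pointwise => i; rewrite /splice.
case: (a <= i < b); [exact: cst_continuous | exact: continuous_coord].
Qed.

(** Tychonoff's theorem. *)
Lemma compact_order_interval (lo hi : zseq R) :
  compact ([set x | le_seq lo x /\ le_seq x hi] : set X).
Proof.
have -> : [set x | le_seq lo x /\ le_seq x hi] =
    [set x : zseq R | forall i, `[lo i, hi i]%classic (x i)].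
  apply/seteqP; split=> [x [h g] i /=|x h].
    by rewrite in_itv /= h g.
  by split=> i; have := h i; rewrite /= in_itv /= => /andP[].
refine (@tychonoff int (fun=> R) (fun i => `[lo i, hi i]%classic) _) => i.
exact: segment_compact.
Qed.

End PointwiseTopology.

Section LatticeEnergy.
Variables (R : realType) (r : nat) (S : 'rV[R]_r.+1 -> R).
Hypothesis hS : lattice_energy S.
Implicit Types (x y z : zseq R) (c : int) (n m : nat).
Local Notation en := (window_energy S).
Local Notation X := {ptws int -> R}.

Lemma shiftS_tau i k l x : shiftS S i (tau k l x) = shiftS S (i - k) x.
Proof.
have SD (xi : 'rV[R]_r.+1) (m : nat) : S (xi + const_mx m%:R) = S xi.
  elim: m => [|m IH].
    by congr (S _); apply/rowP => j; rewrite !mxE addr0.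
  rewrite -IH -[RHS](lattice_energy_periodic hS); congr (S _).
  by apply/rowP => j; rewrite !mxE -addrA natr1.
have SDz (xi : 'rV[R]_r.+1) : S (xi + const_mx l%:~R) = S xi.
  case: l => m; first by rewrite -pmulrn SD.
  rewrite -(SD _ m.+1); congr (S _); apply/rowP => j.
  by rewrite !mxE NegzE mulrNz -pmulrn subrK.
rewrite /shiftS -[RHS]SDz; congr (S _); apply/rowP => j; rewrite !mxE /tau.
by have -> : i + j%:Z - k = i - k + j%:Z by lia.
Qed.

Lemma en_tau c n k l x : en c n (tau k l x) = en (c - k) n x.
Proof.
apply: eq_bigr => j _; rewrite shiftS_tau.
by have -> : c + j%:Z - k = c - k + j%:Z by lia.
Qed.

Lemma en_submodular c n x y :
  en c n (seq_min x y) + en c n (seq_max x y) <= en c n x + en c n y.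
Proof.
rewrite -!big_split /=; apply: ler_sum => k _.
exact: lattice_energy_submodular.
Qed.

Lemma continuous_en c n : continuous (en c n : X -> R).
Proof.
elim: n => [|n IH].
  have -> : (en c 0 : X -> R) = fun=> 0.
    by apply/funext => y; rewrite /window_energy big_geq.
  exact: cst_continuous.
have -> : (en c n.+1 : X -> R) = fun y => en c n y + shiftS S (c + n%:Z) y.
  by apply/funext => y; rewrite /window_energy big_nat_recr.
apply: (@continuous_add_fun R X); first exact: IH.
exact: continuous_shiftS (lattice_energy_continuous hS).
Qed.

(** For each window and each choice of values on its free sites, the defining
    inequality is a closed condition on the sequence. *)
Lemma closed_global_minimizer :
  closed ([set x | global_minimizer S x] : set X).
Proof.
have -> : ([set x | global_minimizer S x] : set X) =
    \bigcap_(d in [set: int * nat * zseq R])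
      [set x : X | en d.1.1 d.1.2 x <=
        en d.1.1 d.1.2 (splice (d.1.1 + r%:Z) (d.1.1 + d.1.2%:Z) x d.2)].
  apply/seteqP; split=> [x /global_minimizerP h [[c n] y] _ /=|x h].
    by apply: h => i hi; rewrite /splice; case: ifP => //; lia.
  apply/global_minimizerP => c n y hy; have := h (c, n, y) I => /=.
  suff -> : splice (c + r%:Z) (c + n%:Z) x y = y by [].
  apply/funext => i; rewrite /splice; case: ifP => // hi.
  by apply: hy; lia.
apply: closed_bigI => -[[c n] y] _ /=.
apply: closed_le_fun; first exact: continuous_en.
move=> x; apply: (@continuous_comp X X R); first exact: continuous_splice.
exact: continuous_en.
Qed.

Lemma global_minimizer_tau k l x :
  global_minimizer S x -> global_minimizer S (tau k l x).
Proof.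
move=> /global_minimizerP h; apply/global_minimizerP => c n y hy.
rewrite -(tauK k l y) en_tau [leRHS]en_tau; apply: h => i hi.
rewrite /tau -hy; last by lia.
by rewrite /tau opprK addrK mulrNz addrK.
Qed.

Section Periodic.
Variables (p : nat) (q : int).

(** Moving the window by one site drops one local energy and adds its
    translate by the period, which has the same value. *)
Lemma en_period_shift c c' x : tau p%:Z q x = x -> en c p x = en c' p x.
Proof.
move=> hx.
have step d : en (d + 1) p x = en d p x.
  have := @en_cat _ _ S d 1 p x; rewrite addnC en_cat.
  have -> : en (d + p%:Z) 1 x = en d 1 x.
    by rewrite -[in LHS]hx en_tau addrK.
  by rewrite addrC => /addrI ->.
have up (d : int) (k : nat) : en (d + k%:Z) p x = en d p x.
  elim: k => [|k IH]; first by rewrite addr0.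
  by rewrite -IH -[RHS]step; congr (window_energy S _ p x); lia.
have [cc|cc] := lerP c c'.
  by rewrite -(up c `|(c' - c)%R|%N); congr (window_energy S _ p x); lia.
by rewrite -(up c' `|(c - c')%R|%N); congr (window_energy S _ p x); lia.
Qed.

Lemma en_periods c n x : tau p%:Z q x = x ->
  en c (n * p) x = n%:R * en 1 p x.
Proof.
move=> hx; elim: n c => [|n IH] c.
  by rewrite mul0n mul0r /window_energy big_geq.
rewrite mulSn en_cat IH (@en_period_shift c 1) // -natr1.
ring.
Qed.

End Periodic.
End LatticeEnergy.

(** * Least minimizers and multiples of the period *)

Section LeastMinimizer.
Variable R : realType.
Local Notation X := {ptws int -> R}.

Lemma continuous_window_sum (c : int) (n : nat) :
  continuous (fun u : X => \sum_(k < n) u (c + (k : nat)%:Z)).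
Proof.
elim: n => [|n IH].
  have -> : (fun u : X => \sum_(k < 0) u (c + (k : nat)%:Z)) = fun=> 0.
    by apply/funext => u; rewrite big_ord0.
  exact: cst_continuous.
have -> : (fun u : X => \sum_(k < n.+1) u (c + (k : nat)%:Z)) =
    fun u => \sum_(k < n) u (c + (k : nat)%:Z) + u (c + n%:Z).
  by apply/funext => u; rewrite big_ord_recr.
by apply: (@continuous_add_fun R X); [exact: IH | exact: continuous_coord].
Qed.

(** Minimize [F], then the sum of the coordinates over the window among the
    minimizers of [F].  By submodularity the minimum of the result [w] and of
    another minimizer is again a minimizer; it lies below [w] and has no
    smaller sum, so it equals [w] on the window, which determines the elements
    of [A]. *)
Lemma least_minimizer (A : set X) (F : X -> R) (c : int) (n : nat) :
  A !=set0 -> compact A -> continuous F ->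
  (forall u v, A u -> A v -> A (seq_min u v) /\ A (seq_max u v)) ->
  (forall u v, F (seq_min u v) + F (seq_max u v) <= F u + F v) ->
  (forall u v, A u -> A v ->
    (forall i : int, c <= i < c + n%:Z -> u i = v i) -> u = v) ->
  exists w, [/\ A w, forall u, A u -> F w <= F u &
    forall u, A u -> F u <= F w -> le_seq w u].
Proof.
move=> A0 cA cF latA subF detA.
have [w0 /set_mem Aw0 minw0] :=
  compact_EVT_min A0 cA (continuous_subspaceT cF).
have {}minw0 u : A u -> F w0 <= F u by move=> Au; apply: minw0; rewrite inE.
pose M := A `&` [set u | F u <= F w0].
have cM : compact M.
  apply: compact_closedI => //; apply: closed_le_fun => //.
  exact: cst_continuous.
have M0 : M !=set0 by exists w0; split => /=.
have [w /set_mem [Aw /= Fw] minw] :=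
  compact_EVT_min M0 cM (continuous_subspaceT (@continuous_window_sum c n)).
exists w; split=> // [u Au|u Au Fuw]; first exact: le_trans Fw (minw0 u Au).
have [Am Amax] := latA w u Aw Au.
have Fm : F (seq_min w u) <= F w0.
  by have := subF w u; have := minw0 _ Amax; lra.
have : \sum_(k < n) w (c + (k : nat)%:Z) <=
       \sum_(k < n) seq_min w u (c + (k : nat)%:Z).
  by apply: minw; rewrite inE.
rewrite -subr_le0 -sumrB => sum_le0.
have ge0 (k : 'I_n) : true ->
    0 <= w (c + (k : nat)%:Z) - seq_min w u (c + (k : nat)%:Z).
  by move=> _; rewrite subr_ge0; exact: seq_min_lel.
have sum0 : \sum_(k < n)
    (w (c + (k : nat)%:Z) - seq_min w u (c + (k : nat)%:Z)) = 0.
  by apply/eqP; rewrite eq_le sum_le0 sumr_ge0.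
rewrite (detA w (seq_min w u)) // => [|i /andP[ci icn]].
  exact: seq_min_ler.
have kn : (`|(i - c)%R| < n)%N by lia.
have /(_ (Ordinal kn) isT) /= := psumr_eq0P ge0 sum0.
have -> : c + `|(i - c)%R|%N%:Z = i by lia.
by move=> /eqP; rewrite subr_eq0 => /eqP.
Qed.

End LeastMinimizer.

Section Periods.

Lemma periodicM (T : Type) (d : int -> T) (P : int) :
  (forall i, d (i + P) = d i) -> forall i k, d (i + k * P) = d i.
Proof.
move=> dP i k.
have up j (m : nat) : d (j + m%:Z * P) = d j.
  elim: m => [|m IH]; first by rewrite mul0r addr0.
  rewrite -[RHS]IH -[RHS]dP; congr d; lia.
case: k => m; first exact: up.
by rewrite -[LHS](up _ m.+1); congr d; rewrite NegzE; lia.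
Qed.

Lemma periodic_mod (T : Type) (d : int -> T) (P : nat) (c : int) :
  (forall i, d (i + P%:Z) = d i) ->
  forall i, d (c + ((i - c) %% P%:Z)%Z) = d i.
Proof.
move=> dP i; rewrite -(periodicM dP _ ((i - c) %/ P%:Z)%Z).
by rewrite -addrA [X in c + X]addrC -divz_eq addrC subrK.
Qed.

Lemma periodic_bounded (R : realType) (d : int -> R) (P : nat) :
  (0 < P)%N -> (forall i, d (i + P%:Z) = d i) ->
  exists M : R, forall i, `|d i| <= M.
Proof.
move=> P0 dP; exists (\sum_(k < P) `|d (k : nat)%:Z|) => i.
rewrite -(periodic_mod 0 dP) add0r subr0.
have ge0 : (0 <= (i %% P%:Z)%Z) by apply: modz_ge0; lia.
have ltP : ((i %% P%:Z)%Z < P%:Z) by apply: ltz_pmod; lia.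
have kP : (`|(i %% P%:Z)%Z| < P)%N by lia.
rewrite (bigD1 (Ordinal kP)) //= gez0_abs // lerDl.
exact: sumr_ge0.
Qed.

End Periods.

Section PeriodicMinimizers.
Variables (R : realType) (r : nat) (S : 'rV[R]_r.+1 -> R).
Hypothesis hS : lattice_energy S.
Variables (p : nat) (q : int).
Hypothesis hp : (0 < p)%N.
Implicit Types (x y z : zseq R) (c : int) (n m : nat).
Local Notation en := (window_energy S).
Local Notation X := {ptws int -> R}.

Lemma periodic_energyE x : periodic_energy S p x = en 1 p x.
Proof.
rewrite /periodic_energy /window_energy big_add1 /=.
by apply: eq_bigr => k _; congr (shiftS S _ x); lia.
Qed.

Lemma pq_minimizers_tau k l x :
  pq_minimizers S p q x -> pq_minimizers S p q (tau k l x).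
Proof.
move=> [px mx]; split=> [|y py].
  by rewrite /periodic_seqs /= tau_add addrC (addrC q) -tau_add px.
rewrite periodic_energyE en_tau // (en_period_shift hS _ 1 px).
by rewrite -periodic_energyE; exact: mx.
Qed.

Lemma closed_tau_fix k l : closed ([set x | tau k l x = x] : set X).
Proof.
have -> : ([set x | tau k l x = x] : set X) =
    \bigcap_(i in [set: int])
      ([set x : X | x (i - k) + l%:~R <= x i] `&`
       [set x : X | x i <= x (i - k) + l%:~R]).
  apply/seteqP; split=> [x /= hx i _ /=|x h /=].
    by rewrite -[in X in X /\ _](congr1 (@^~ i) hx) -[in X in _ /\ X](congr1 (@^~ i) hx).
  by apply/funext => i; have [/= h1 h2] := h i I; apply/eqP; rewrite eq_le h1 h2.
have ct i : continuous (fun x : X => x (i - k) + l%:~R).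
  by apply: (@continuous_add_fun R X); [exact: continuous_coord | exact: cst_continuous].
apply: closed_bigI => i _; apply: closedI; apply: closed_le_fun => //;
  exact: continuous_coord.
Qed.

(** Minimizers over n periods have no less energy than n times one period.
    The least minimizer [w] in a box around [x] satisfies [w <= tau p q w],
    because its translate is a minimizer in the same box; n such steps return
    to [w], so [w] has period p and its energy is n times that of one period.
    *)
Lemma pq_minimizers_multiple x y n : (0 < n)%N ->
  pq_minimizers S p q x ->
  tau (n * p)%N%:Z (n%:Z * q) y = y ->
  n%:R * en 1 p x <= en 1 (n * p) y.
Proof.
move=> n0 [px mx] py.
have tx : tau (n * p)%N%:Z (n%:Z * q) x = x.
  by have := tau_fixM n px; rewrite mulrC [q * _]mulrC.
have shiftE z i : tau (n * p)%N%:Z (n%:Z * q) z = z ->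
    z (i + (n * p)%N%:Z) = z i + (n%:Z * q)%:~R.
  by move=> hz; rewrite -[in LHS]hz /tau addrK.
have nP : (0 < n * p)%N by rewrite muln_gt0 n0.
have [M hM] : exists M : R, forall i, `|y i - x i| <= M.
  apply: (@periodic_bounded _ (fun i => y i - x i) (n * p)) => // i.
  by rewrite !shiftE // opprD addrACA subrr addr0.
pose lo : zseq R := fun i => x i - M; pose hi : zseq R := fun i => x i + M.
pose A := ([set u | le_seq lo u /\ le_seq u hi] `&`
  [set u | tau (n * p)%N%:Z (n%:Z * q) u = u]) : set X.
have Ay : A y.
  split=> //; split=> i; have := hM i; rewrite ler_norml /lo /hi; lra.
have cA : compact A.
  by apply: compact_closedI; [exact: compact_order_interval | exact: closed_tau_fix].
have latA u v : A u -> A v -> A (seq_min u v) /\ A (seq_max u v).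
  move=> [[u1 u2] u3] [[v1 v2] v3]; split; (split; last first).
  - by rewrite /= tau_min u3 v3.
  - split; first exact: le_seq_min.
    exact: le_seq_trans (seq_min_lel u v) u2.
  - by rewrite /= tau_max u3 v3.
  - split; last exact: le_seq_max.
    exact: le_seq_trans u1 (seq_max_gel u v).
have detA u v : A u -> A v ->
    (forall i : int, 1 <= i < 1 + (n * p)%N%:Z -> u i = v i) -> u = v.
  move=> [_ u3] [_ v3] huv; apply/funext => i.
  have dP j : u (j + (n * p)%N%:Z) - v (j + (n * p)%N%:Z) = u j - v j.
    by rewrite !shiftE // opprD addrACA subrr addr0.
  apply/eqP; rewrite -subr_eq0; apply/eqP.
  rewrite -(@periodic_mod _ (fun j => u j - v j) _ 1 dP) huv ?subrr //.
  have : (0 <= ((i - 1) %% (n * p)%N%:Z)%Z) by apply: modz_ge0; lia.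
  have : (((i - 1) %% (n * p)%N%:Z)%Z < (n * p)%N%:Z) by apply: ltz_pmod; lia.
  lia.
have [w [[[w1 w2] w3] minw leastw]] := @least_minimizer R A (en 1 (n * p)) 1 (n * p)
  (ex_intro _ y Ay) cA (@continuous_en _ _ _ hS _ _) latA (@en_submodular _ _ _ hS _ _) detA.
have wtw : le_seq w (tau p%:Z q w).
  apply: leastw.
    split; last by rewrite /= tau_add addrC (addrC (n%:Z * q)) -tau_add w3.
    split=> i; rewrite /tau /lo /hi -[x i](congr1 (@^~ i) px) /tau.
      by have := w1 (i - p%:Z); rewrite /lo; lra.
    by have := w2 (i - p%:Z); rewrite /hi; lra.
  by rewrite en_tau // (en_period_shift hS _ 1 w3).
have tw : tau p%:Z q w = w.
  apply: le_seq_anti => //.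
  rewrite -{2}w3 PoszM mulrC [_ * q]mulrC -tau_iter.
  case: n n0 {w1 w2 w3 minw leastw latA detA cA Ay A hM lo hi nP shiftE tx py} => // n _.
  elim: n => [|n IH]; first by [].
  by rewrite iterS; apply: le_tau; exact: le_seq_trans wtw IH.
apply: le_trans (minw y Ay).
rewrite (en_periods hS _ _ tw) ler_wpM2l ?ler0n //.
by rewrite -!periodic_energyE; exact: mx.
Qed.

End PeriodicMinimizers.

(** * Periodic minimizers, and the gap between two of them *)

Lemma periodic_extension (R : realType) (P : nat) (Q c : int) (y : zseq R) :
  (0 < P)%N -> exists Y : zseq R, tau P%:Z Q Y = Y /\
    forall i : int, c <= i < c + P%:Z -> Y i = y i.
Proof.
move=> P0; have P0z : P%:Z != 0 by lia.
exists (fun i => y (c + ((i - c) %% P%:Z)%Z) +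
          (((i - c) %/ P%:Z)%Z * Q)%:~R); split=> [|i hi].
  apply/funext => i; rewrite /tau.
  have -> : i - P%:Z - c = (-1) * P%:Z + (i - c) by ring.
  rewrite modzMDl divzMDl // -addrA -intrD; congr (_ + _%:~R); ring.
rewrite modz_small; last by lia.
rewrite divz_small; last by lia.
by rewrite mul0r addr0 addrC subrK.
Qed.

Lemma le0_of_multiples (R : realType) (d M : R) (n0 : nat) :
  (forall n, (n0 <= n)%N -> n%:R * d <= M) -> d <= 0.
Proof.
move=> h; rewrite leNgt; apply/negP => d0.
have /archi_boundP : 0 <= `|M| / d by rewrite divr_ge0 // ltW.
set m := Num.bound _; rewrite ltr_pdivrMr // => hm.
have := h (n0 + m)%N (leq_addr _ _); rewrite natrD mulrDl.
have : 0 <= n0%:R * d by rewrite mulr_ge0 // ltW.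
have := ler_norm M; lra.
Qed.

Section PeriodicAreGlobal.
Variables (R : realType) (r : nat) (S : 'rV[R]_r.+1 -> R).
Hypothesis hS : lattice_energy S.
Variables (p : nat) (q : int).
Hypothesis hp : (0 < p)%N.
Implicit Types (x y z : zseq R) (c : int) (n m : nat).
Local Notation en := (window_energy S).
Local Notation X := {ptws int -> R}.

(** A competitor for a bounded window is cut to a number of periods exceeding
    the window by the range of the interaction and then repeated periodically;
    the repetition has the same energy over one large period, and
    [pq_minimizers_multiple] applies. *)
Lemma pq_minimizer_global x : pq_minimizers S p q x -> global_minimizer S x.
Proof.
move=> hx; have px : tau p%:Z q x = x := hx.1.
apply/global_minimizerP => c n y hy.
(* The period must exceed the window by the range r, so that every
   local energy of the window c, ..., c + P - 1 sees a single copy of the change. *)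
pose m := (n + r + 1)%N; pose P := (m * p)%N.
have nP : (n + r < P)%N.
  by rewrite /P /m; apply: leq_trans (leq_pmulr _ hp); lia.
have [Y [tY YE]] := @periodic_extension R P (m%:Z * q) c y (leq_ltn_trans (leq0n _) nP).
have tx : tau P%:Z (m%:Z * q) x = x.
  by have := tau_fixM m px; rewrite mulrC [q * _]mulrC.
have Yy : en c P Y = en c P y.
  apply: en_local => j hj; have [jP|jP] := ltrP j (c + P%:Z).
    by apply: YE; lia.
  rewrite -tY /tau YE; last by lia.
  by rewrite -hy -?(hy j) -1?[x j](congr1 (@^~ j) tx) //; lia.
have hcn : c + n%:Z <= c + P%:Z by lia.
rewrite -subr_ge0 -(en_widen S (lexx c) hcn hy) subr_ge0 -Yy.
rewrite (en_period_shift hS _ 1 tx) (en_period_shift hS _ 1 tY).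
rewrite (en_periods hS _ _ px).
apply: (pq_minimizers_multiple hS hp _ hx tY).
by rewrite /m addn1.
Qed.

Lemma pq_minimizers_lattice x y :
  pq_minimizers S p q x -> pq_minimizers S p q y ->
  pq_minimizers S p q (seq_min x y) /\ pq_minimizers S p q (seq_max x y).
Proof.
move=> [px mx] [py my].
have pm : periodic_seqs p q (seq_min x y) by rewrite /periodic_seqs /= tau_min px py.
have pM : periodic_seqs p q (seq_max x y) by rewrite /periodic_seqs /= tau_max px py.
have := en_submodular hS 1 p x y; rewrite -!periodic_energyE => sub.
have := mx _ pm; have := mx _ pM; have := my _ pm; have := my _ pM => h1 h2 h3 h4.
split; split=> // z pz.
  by have := mx _ pz; lra.
by have := mx _ pz; lra.
Qed.

End PeriodicAreGlobal.

Section Gap.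
Variables (R : realType) (r : nat) (S : 'rV[R]_r.+1 -> R).
Hypothesis hS : lattice_energy S.
Variables (p : nat) (q : int).
Hypothesis hp : (0 < p)%N.
Variables lo hi : zseq R.
Hypothesis hlo : pq_minimizers S p q lo.
Hypothesis hhi : pq_minimizers S p q hi.
Hypothesis lohi : lt_seq lo hi.
Hypothesis hgap : ~ exists y : zseq R,
  [/\ pq_minimizers S p q y, lt_seq lo y & lt_seq y hi].
Implicit Types (x y z : zseq R) (c : int) (n m : nat).
Local Notation en := (window_energy S).
Local Notation X := {ptws int -> R}.

Let le_lohi : le_seq lo hi. Proof. by move=> i; exact: ltW. Qed.

Lemma gap_between z : pq_minimizers S p q z -> le_seq lo z -> le_seq z hi ->
  z = lo \/ z = hi.
Proof.
move=> hz loz zhi; have gz := pq_minimizer_global hS hp hz.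
have [[i zi]|nlo] := pselect (exists i, lo i = z i).
  left; apply/esym; apply: (lattice_energy_touching hS _ _ _ zi) => //.
  exact: pq_minimizer_global hlo.
have [[i zi]|nhi] := pselect (exists i, z i = hi i).
  right; apply: (lattice_energy_touching hS _ _ _ zi) => //.
  exact: pq_minimizer_global hhi.
case: hgap; exists z; split=> // i; rewrite lt_neqAle ?loz ?zhi andbT.
  by apply/eqP => e; apply: nlo; exists i.
by apply/eqP => e; apply: nhi; exists i.
Qed.

(** Truncating [z] to the strip gives a p-q-minimizer between [lo] and [hi],
    which is [lo] or [hi]; reading this at each site locates [z]. *)
Lemma gap_total z : pq_minimizers S p q z -> le_seq z lo \/ le_seq hi z.
Proof.
move=> hz; pose u := seq_min (seq_max z lo) hi.
have hu : pq_minimizers S p q u.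
  apply: (pq_minimizers_lattice hS _ hhi).1.
  exact: (pq_minimizers_lattice hS hz hlo).2.
have [uE|uE] : u = lo \/ u = hi.
- apply: gap_between => //; last exact: seq_min_ler.
  by apply: le_seq_min => //; exact: seq_max_ger.
- left => i; have := congr1 (@^~ i) uE; have := lohi i; rewrite /u /seq_min /seq_max.
  case: (lerP (z i) (lo i)) => // hz0; case: (lerP (z i) (hi i)) => _ ltlohi ee.
    by move: hz0; rewrite ee ltxx.
  by move: ltlohi; rewrite ee ltxx.
- right => i; have := congr1 (@^~ i) uE; have := lohi i; rewrite /u /seq_min /seq_max.
  case: (lerP (z i) (lo i)) => hz0; last first.
    by case: (lerP (z i) (hi i)) => [_ _ -> //|/ltW].
  case: (lerP (lo i) (hi i)) => [_ ltlohi ee|/ltW hl lh _].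
    by move: ltlohi; rewrite ee ltxx.
  by move: lh; rewrite ltNge hl.
Qed.

Definition strip : set X := [set x | le_seq lo x /\ le_seq x hi].

Lemma fix_lo (m : int) : tau (p%:Z * m) (q * m) lo = lo.
Proof. exact: tau_fixM hlo.1. Qed.

Lemma fix_hi (m : int) : tau (p%:Z * m) (q * m) hi = hi.
Proof. exact: tau_fixM hhi.1. Qed.

Lemma strip_tau (m : int) x : strip x -> strip (tau (p%:Z * m) (q * m) x).
Proof.
move=> [lox xhi]; split; first by rewrite -(fix_lo m); exact: le_tau.
by rewrite -(fix_hi m); exact: le_tau.
Qed.

(** The windows of length [r] in front of a multiple of the period carry the
    interaction across a cut; by compactness and translation their energy is
    bounded uniformly. *)
Lemma strip_en_bound : exists C : R, forall x (b : int), strip x ->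
  `|en (b * p%:Z - r%:Z) r x| <= C.
Proof.
have cI : compact strip by exact: compact_order_interval.
have I0 : strip !=set0 by exists lo; split.
have cf : continuous (fun x : X => `|en (- r%:Z) r x|).
  move=> x; apply: (@continuous_comp X R R (en (- r%:Z) r)).
    exact: continuous_en.
  exact: norm_continuous.
have [w _ hw] := compact_EVT_max I0 cI (continuous_subspaceT cf).
exists `|en (- r%:Z) r w| => x b hx.
have := strip_tau (- b) hx; set x' := tau _ _ x => hx'.
have -> : en (b * p%:Z - r%:Z) r x = en (- r%:Z) r x'.
  by rewrite /x' en_tau //; congr (window_energy S _ r x); lia.
by apply: hw; rewrite inE.
Qed.

(** Replacing [z] by [lo] over n periods changes the energy by n times the
    difference of the energies per period, up to cut terms bounded
    independently of n; minimality of [z] for every n makes the difference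
    nonpositive. *)
Lemma global_periodic_pq_minimizer z :
  strip z -> tau p%:Z q z = z -> global_minimizer S z ->
  pq_minimizers S p q z.
Proof.
move=> sz pz /global_minimizerP gz; split=> // y py.
suff : en 1 p z <= en 1 p lo.
  rewrite -!periodic_energyE => h; exact: le_trans h (hlo.2 y py).
have [C hC] := strip_en_bound.
rewrite -subr_le0; apply: (@le0_of_multiples _ _ (4 * C) r) => n rn.
have rN : (r <= n * p)%N by apply: leq_trans (leq_pmulr _ hp).
set N := (n * p)%N in rN.
pose y' := splice 0 N%:Z z lo.
have sy' : strip y'.
  split=> i; rewrite /y' /splice; case: ifP => _ //; [exact: sz.1 | exact: sz.2].
have : en (- r%:Z) (r + N) z <= en (- r%:Z) (r + N) y'.
  by apply: gz => i hi0; rewrite /y' /splice; case: ifP => //; lia.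
have NE : N = ((N - r) + r)%N by lia.
rewrite !en_cat addNr (en_periods hS _ _ pz).
have -> : en 0 N y' = en 0 (N - r) lo + en (N%:Z - r%:Z) r y'.
  rewrite {1}NE en_cat; congr (_ + _).
    apply: en_local => j hj; rewrite /y' /splice ifT //; lia.
  by congr (window_energy S _ r y'); lia.
have : n%:R * en 1 p lo = en 0 (N - r) lo + en (N%:Z - r%:Z) r lo.
  rewrite -(en_periods hS 0 n hlo.1) -/N {1}NE en_cat; congr (_ + _).
  by congr (window_energy S _ r lo); lia.
have := hC z 0 sz; have := hC y' 0 sy'; have := hC y' n sy'.
have := hC lo n (conj (fun=> lexx _) le_lohi).
rewrite -PoszM -/N mul0r sub0r !ler_norml mulrBr; lra.
Qed.

End Gap.

(** * Transitions from the lower to the upper periodic minimizer *)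

Section Transitions.
Variables (R : realType) (r : nat) (S : 'rV[R]_r.+1 -> R).
Hypothesis hS : lattice_energy S.
Variables lo hi : zseq R.
Hypothesis lohi : lt_seq lo hi.
Implicit Types (x y z u w : zseq R) (a b c s : int) (n m : nat).
Local Notation en := (window_energy S).
Local Notation X := {ptws int -> R}.

(** The two extreme transitions with free sites i such that a <= i < b are
    [step b], the smallest, and [step a], the largest; the others are the
    sequences between these two. *)
Definition step s : zseq R := fun i => if i < s then lo i else hi i.

Definition transition a b : set X :=
  [set x | le_seq (step b) x /\ le_seq x (step a)].

(** The quantification over all windows [(c, n)] that contain the transition
    makes the notion independent of a choice of window, so that minimizers on
    different transition windows can be compared. *)
Definition least_transition a b w : Prop :=
  transition a b w /\ forall u, transition a b u -> forall c n,
    c + r%:Z <= a -> b <= c + n%:Z ->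
    en c n w <= en c n u /\ (en c n u <= en c n w -> le_seq w u).

Lemma step_le s s' : s <= s' -> le_seq (step s') (step s).
Proof.
move=> ss i; rewrite /step; case: ifP; case: ifP => //; last by lia.
by move=> _ _; exact: ltW.
Qed.

Lemma step_strip s : strip lo hi (step s).
Proof. by split=> i; rewrite /step; case: ifP => // _; exact: ltW. Qed.

Lemma transition_strip a b x : transition a b x -> strip lo hi x.
Proof.
move=> [bx xa]; split.
  exact: le_seq_trans (step_strip b).1 bx.
exact: le_seq_trans xa (step_strip a).2.
Qed.

Lemma transition_left a b x i : a <= b -> transition a b x -> i < a -> x i = lo i.
Proof.
move=> ab [bx xa] ia; apply/eqP; rewrite eq_le.
have := xa i; have := bx i; rewrite /step ia ifT; last by lia.
by move=> -> ->.
Qed.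

Lemma transition_right a b x i : a <= b -> transition a b x -> b <= i -> x i = hi i.
Proof.
move=> ab [bx xa] bi; apply/eqP; rewrite eq_le.
have := xa i; have := bx i; rewrite /step ifF; last by lia.
by rewrite ifF; [move=> -> -> | lia].
Qed.

Lemma transitionP a b x : strip lo hi x ->
  (forall i : int, i < a -> x i = lo i) -> (forall i : int, b <= i -> x i = hi i) ->
  transition a b x.
Proof.
move=> [lox xhi] hl hr; split=> i; rewrite /step.
  by case: ifP => // hi0; rewrite hr //; lia.
by case: ifP => // hi0; rewrite hl.
Qed.

Lemma transition_widen a b a' b' x : a' <= a -> b <= b' ->
  transition a b x -> transition a' b' x.
Proof.
move=> ha hb [bx xa]; split.
  exact: le_seq_trans (step_le hb) bx.
exact: le_seq_trans xa (step_le ha).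
Qed.

Lemma least_transition_exists a b : a <= b -> exists w, least_transition a b w.
Proof.
move=> ab.
have A0 : transition a b !=set0.
  by exists (step a); split; [exact: step_le | move=> i; exact: lexx].
have latA u v : transition a b u -> transition a b v ->
    transition a b (seq_min u v) /\ transition a b (seq_max u v).
  move=> [u1 u2] [v1 v2]; split; split.
  - exact: le_seq_min.
  - exact: le_seq_trans (seq_min_lel u v) u2.
  - exact: le_seq_trans u1 (seq_max_gel u v).
  - exact: le_seq_max.
have detA u v : transition a b u -> transition a b v ->
    (forall i : int, a <= i < a + `|(b - a)%R|%N%:Z -> u i = v i) -> u = v.
  move=> tu tv huv; apply/funext => i.
  have [ia|ai] := ltrP i a; first by rewrite !(transition_left ab).
  have [ib|bi] := ltrP i b; last by rewrite !(transition_right ab).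
  by apply: huv; lia.
pose n0 := `|(b - a + r%:Z)%R|%N.
have [w [Aw minw leastw]] := @least_minimizer R (transition a b)
  (en (a - r%:Z) n0) a `|(b - a)%R|%N A0 (@compact_order_interval _ _ _)
  (@continuous_en _ _ _ hS _ _) latA (@en_submodular _ _ _ hS _ _) detA.
exists w; split=> // u Au c n ca bn.
have agree i : (i < a - r%:Z + r%:Z) || (a - r%:Z + n0%:Z <= i) -> w i = u i.
  case/orP => hi0.
    by rewrite !(transition_left ab) //; lia.
  by rewrite !(transition_right ab) //; rewrite /n0 in hi0; lia.
have hc : c <= a - r%:Z by lia.
have hn : a - r%:Z + n0%:Z <= c + n%:Z by rewrite /n0; lia.
have := en_widen S hc hn agree; have := minw u Au => h1 h2.
split; first by lra.
by move=> h3; apply: leastw => //; lra.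
Qed.

(** The minimum of [u] and [w] is a transition for the right window and their
    maximum one for the left window.  By submodularity and minimality of [u]
    the minimum has energy at most that of [w], so [w], being least, lies
    below it. *)
Lemma least_transition_le a b a' b' u w : a <= a' -> b <= b' ->
  a <= b -> least_transition a b u -> least_transition a' b' w -> le_seq w u.
Proof.
move=> aa bb ab [[u1 u2] minu] [[w1 w2] minw].
have tm : transition a' b' (seq_min u w).
  split; last exact: le_seq_trans (seq_min_ler u w) w2.
  by apply: le_seq_min => //; exact: le_seq_trans (step_le bb) u1.
have tM : transition a b (seq_max u w).
  split; first exact: le_seq_trans u1 (seq_max_gel u w).
  by apply: le_seq_max => //; exact: le_seq_trans w2 (step_le aa).
pose n := `|(b' - a + r%:Z)%R|%N.
have hn : b' <= a - r%:Z + n%:Z by rewrite /n; lia.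
have hn' : b <= a - r%:Z + n%:Z by lia.
have ha : a - r%:Z + r%:Z <= a by lia.
have ha' : a - r%:Z + r%:Z <= a' by lia.
have [h1 _] := minu _ tM _ _ ha hn'.
have [_ h2] := minw _ tm _ _ ha' hn.
have h3 := @en_submodular _ _ _ hS (a - r%:Z) n u w.
apply: le_seq_trans (seq_min_lel u w); apply: h2; lra.
Qed.

Lemma transition_tau k l a b x :
  tau k l lo = lo -> tau k l hi = hi ->
  transition a b x -> transition (a + k) (b + k) (tau k l x).
Proof.
move=> tlo thi [bx xa].
have ts s : step (s + k) = tau k l (step s).
  apply/funext => i; rewrite /step -[in LHS]tlo -[in LHS]thi /tau.
  by rewrite ltrBlDr; case: ifP.
by rewrite /transition /= !ts; split; exact: le_tau.
Qed.

Lemma least_transition_tau k l a b x :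
  tau k l lo = lo -> tau k l hi = hi ->
  least_transition a b x -> least_transition (a + k) (b + k) (tau k l x).
Proof.
move=> tlo thi [tx minx]; split; first exact: transition_tau.
move=> u tu c n ca bn.
have := transition_tau (tau_fixV tlo) (tau_fixV thi) tu; rewrite !addrK => tu'.
have hc : c - k + r%:Z <= a by lia.
have hn : b <= c - k + n%:Z by lia.
have := minx _ tu' _ _ hc hn; rewrite !en_tau // opprK subrK => -[h1 h2].
by split=> // h; rewrite -(tauK k l u); apply: le_tau; exact: h2.
Qed.

(** The translate is the least transition on the window moved by [k] to the
    right. *)
Lemma least_transition_monotone k l a b x : a <= b -> 0 <= k ->
  tau k l lo = lo -> tau k l hi = hi ->
  least_transition a b x -> le_seq (tau k l x) x.
Proof.
move=> ab k0 tlo thi lx.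
apply: (least_transition_le _ _ ab lx (least_transition_tau tlo thi lx)); lia.
Qed.

End Transitions.

(** * Renormalized energy of transitions *)

Section RenormalizedEnergy.
Variables (R : realType) (r : nat) (S : 'rV[R]_r.+1 -> R).
Hypothesis hS : lattice_energy S.
Variables (p : nat) (q : int).
Hypothesis hp : (0 < p)%N.
Variables lo hi : zseq R.
Hypothesis hlo : pq_minimizers S p q lo.
Hypothesis hhi : pq_minimizers S p q hi.
Hypothesis lohi : lt_seq lo hi.
Implicit Types (x y z u w : zseq R) (a b c s : int) (n m k : nat).
Local Notation en := (window_energy S).
Local Notation X := {ptws int -> R}.
Local Notation transition := (transition lo hi).
Local Notation strip := (strip lo hi).

Let glo : global_minimizer S lo := pq_minimizer_global hS hp hlo.
Let en_hi_lo : en 1 p hi = en 1 p lo.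
Proof.
apply/eqP; rewrite eq_le -!periodic_energyE.
by rewrite (hlo.2 _ hhi.1) (hhi.2 _ hlo.1).
Qed.

(** The energy of [k] periods from the period [c] on, minus what the periodic
    minimizers spend there.  For a transition inside the window it does not
    depend on the window. *)
Definition renormalized_energy c k x : R :=
  en (c * p%:Z) (k * p) x - k%:R * en 1 p lo.
Local Notation ren := renormalized_energy.

Lemma renormalized_energy_widen a b c k c' k' x : a <= b ->
  transition (a * p%:Z) (b * p%:Z) x ->
  c + r%:Z <= a -> b <= c + k%:Z -> c' <= c -> c + k%:Z <= c' + k'%:Z ->
  ren c' k' x = ren c k x.
Proof.
move=> ab tx ca bk cc kk.
have abp : a * p%:Z <= b * p%:Z by apply: ler_wpM2r.
have -> : k' = (`|(c - c')%R| + (k + `|(c' + k'%:Z - (c + k%:Z))%R|))%N by lia.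
set k1 := `|(c - c')%R|%N; set k2 := `|_|%N.
have cE : c' * p%:Z + (k1 * p)%N%:Z = c * p%:Z.
  by rewrite PoszM -mulrDl /k1; congr (_ * _); lia.
rewrite /ren !mulnDl !en_cat cE !natrD.
have -> : en (c' * p%:Z) (k1 * p) x = k1%:R * en 1 p lo.
  rewrite -(en_periods hS (c' * p%:Z) k1 hlo.1); apply: en_local => j hj.
  apply: (transition_left abp tx).
  have : (c + r%:Z) * p%:Z <= a * p%:Z by apply: ler_wpM2r.
  have : r%:Z <= r%:Z * p%:Z by nia.
  lia.
have -> : en (c * p%:Z + (k * p)%N%:Z) (k2 * p) x = k2%:R * en 1 p lo.
  rewrite -en_hi_lo -(en_periods hS (c * p%:Z + (k * p)%N%:Z) k2 hhi.1).
  apply: en_local => j hj; apply: (transition_right abp tx).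
  have : b * p%:Z <= (c + k%:Z) * p%:Z by apply: ler_wpM2r.
  lia.
ring.
Qed.

Lemma renormalized_energy_window a b c k c' k' x : a <= b ->
  transition (a * p%:Z) (b * p%:Z) x ->
  c + r%:Z <= a -> b <= c + k%:Z -> c' + r%:Z <= a -> b <= c' + k'%:Z ->
  ren c' k' x = ren c k x.
Proof.
move=> ab tx ca bk ca' bk'.
pose d := Num.min c c'; pose e := Num.max (c + k%:Z) (c' + k'%:Z).
have dE : d <= c /\ d <= c' by rewrite /d; lia.
have eE : c + k%:Z <= e /\ c' + k'%:Z <= e by rewrite /e; lia.
have ke : e = d + `|(e - d)%R|%N%:Z by lia.
rewrite -(@renormalized_energy_widen a b c k d `|(e - d)%R|%N) //; try lia.
by rewrite -(@renormalized_energy_widen a b c' k' d `|(e - d)%R|%N) //; lia.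
Qed.

Lemma renormalized_energy_tau a c k x :
  ren c k (tau (p%:Z * a) (q * a) x) = ren (c - a) k x.
Proof.
rewrite /ren en_tau //; congr (window_energy S _ _ x - _).
by rewrite mulrBl [a * _]mulrC.
Qed.

(** Replace the part of the transition to the right of its window by [lo].
    The outcome is a compact perturbation of the global minimizer [lo], and
    only the [r] local energies in front of the cut differ from those of the
    transition or of [hi]. *)
Lemma renormalized_energy_bound : exists C : R, forall a b c k x, a <= b ->
  transition (a * p%:Z) (b * p%:Z) x ->
  c + r%:Z <= a -> b <= c + k%:Z -> C <= ren c k x.
Proof.
have [C hC] := strip_en_bound hS hp hlo hhi lohi.
exists (- (2 * C)) => a b c k x ab tx ca bk.
have abp : a * p%:Z <= b * p%:Z by apply: ler_wpM2r.
have sx : strip x := transition_strip lohi tx.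
pose y : zseq R := fun i => if i < b * p%:Z then x i else lo i.
have sy : strip y.
  split=> i; rewrite /y; case: ifP => _; rewrite ?sx.1 ?sx.2 //.
  exact: ltW.
have loy : en (c * p%:Z) (k * p) lo <= en (c * p%:Z) (k * p) y.
  move/global_minimizerP: glo; apply => i hi0; rewrite /y.
  case: ifP => // ib; rewrite (transition_left abp tx) //.
  have : (c + r%:Z) * p%:Z <= a * p%:Z by apply: ler_wpM2r.
  have : r%:Z <= r%:Z * p%:Z by nia.
  have : b * p%:Z <= (c + k%:Z) * p%:Z by apply: ler_wpM2r.
  lia.
pose k1 := `|(b - c)%R|%N; pose k2 := `|(c + k%:Z - b)%R|%N.
have kE : k = (k1 + k2)%N by rewrite /k1 /k2; lia.
have rk1 : (r <= k1 * p)%N by apply: leq_trans (leq_pmulr _ hp); rewrite /k1; lia.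
have bE : c * p%:Z + (k1 * p)%N%:Z = b * p%:Z.
  by rewrite PoszM -mulrDl /k1; congr (_ * _); lia.
have split_en z : en (c * p%:Z) (k * p) z =
    en (c * p%:Z) (k1 * p - r) z + en (b * p%:Z - r%:Z) r z +
    en (b * p%:Z) (k2 * p) z.
  rewrite kE mulnDl en_cat bE -{1}(subnK rk1) en_cat.
  by congr (_ + window_energy S _ r z + _); lia.
have right1 : en (b * p%:Z) (k2 * p) x = k2%:R * en 1 p lo.
  rewrite -en_hi_lo -(en_periods hS (b * p%:Z) k2 hhi.1); apply: en_local => j hj.
  by apply: (transition_right abp tx); lia.
have right2 : en (b * p%:Z) (k2 * p) y = k2%:R * en 1 p lo.
  rewrite -(en_periods hS (b * p%:Z) k2 hlo.1); apply: en_local => j hj.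
  by rewrite /y ifF //; lia.
have left : en (c * p%:Z) (k1 * p - r) y = en (c * p%:Z) (k1 * p - r) x.
  by apply: en_local => j hj; rewrite /y ifT //; lia.
move: loy; rewrite /ren (en_periods hS _ _ hlo.1) !split_en.
have := hC x b sx; have := hC y b sy; rewrite !ler_norml left right1 right2.
lra.
Qed.

End RenormalizedEnergy.

(** * Limits of centered transitions are global minimizers *)

Lemma cluster_closed (T : topologicalType) (u : nat -> T) (x : T) (C : set T) :
  cluster (u @ \oo) x -> closed C -> (forall n, C (u n)) -> C x.
Proof.
move=> cx cC uC; apply: cC => B hB.
have FC : (u @ \oo) C by exists 0%N => // n _; exact: uC.
have [z [Cz Bz]] := cx C B FC hB.
by exists z.
Qed.

Lemma cluster_frequently (T : topologicalType) (u : nat -> T) (x : T)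
    (B : set T) (N : nat) :
  cluster (u @ \oo) x -> nbhs x B -> exists2 n, (N <= n)%N & B (u n).
Proof.
move=> cx hB.
have FN : (u @ \oo) (u @` [set n | (N <= n)%N]).
  by exists N => // n /= Nn; exists n.
by have [_ [[n /= Nn <-] Bn]] := cx _ _ FN hB; exists n.
Qed.

Section Cluster.
Variables (R : realType) (r : nat) (S : 'rV[R]_r.+1 -> R).
Hypothesis hS : lattice_energy S.
Variables (p : nat) (q : int).
Hypothesis hp : (0 < p)%N.
Variables lo hi : zseq R.
Hypothesis hlo : pq_minimizers S p q lo.
Hypothesis hhi : pq_minimizers S p q hi.
Hypothesis lohi : lt_seq lo hi.
Implicit Types (x y z u w : zseq R) (a b c s : int) (n m k : nat).
Local Notation en := (window_energy S).
Local Notation X := {ptws int -> R}.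
Local Notation ren := (renormalized_energy S p lo).

Let glo : global_minimizer S lo := pq_minimizer_global hS hp hlo.
Let ghi : global_minimizer S hi := pq_minimizer_global hS hp hhi.

(** Truncation to the strip does not raise the energy, because [lo] and [hi]
    are global minimizers themselves. *)
Lemma strip_competitor x c n y : strip lo hi x ->
  (forall i : int, (i < c + r%:Z) || (c + n%:Z <= i) -> x i = y i) ->
  exists y', [/\ strip lo hi y',
    forall i : int, (i < c + r%:Z) || (c + n%:Z <= i) -> x i = y' i &
    en c n y' <= en c n y].
Proof.
move=> [lox xhi] hy.
exists (seq_min (seq_max y lo) hi); split.
- split; last exact: seq_min_ler.
  apply: le_seq_min; first exact: seq_max_ger.
  by move=> i; exact: ltW.
- move=> i hi0; rewrite /seq_min /seq_max -hy // (max_l (lox i)).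
  by rewrite (min_l (xhi i)).
- have h1 : en c n lo <= en c n (seq_min y lo).
    move/global_minimizerP: glo; apply => i hi0.
    by rewrite /seq_min -hy // (min_r (lox i)).
  have h2 : en c n hi <= en c n (seq_max (seq_max y lo) hi).
    move/global_minimizerP: ghi; apply => i hi0.
    by rewrite /seq_max -hy // (max_l (lox i)) (max_r (xhi i)).
  have h3 := @en_submodular _ _ _ hS c n y lo.
  have h4 := @en_submodular _ _ _ hS c n (seq_max y lo) hi.
  lra.
Qed.

(** Suppose that replacing [x] by [y] on a bounded window gains [g x > 0].
    Near [x] the gain exceeds half of it.  For infinitely many n the same
    replacement in [u n] gives a transition on a larger window whose
    renormalized energy is below the infimum, since the minimal transition
    itself exceeds the infimum by less than half of [g x] once its window has
    room for a translate of a nearly optimal transition. *)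
Lemma cluster_global_minimizer (u : nat -> X) (a : nat -> int) (x : X) :
  (forall n, least_transition S lo hi (a n * p%:Z) ((a n + n%:Z) * p%:Z) (u n)) ->
  cluster (u @ \oo) x -> strip lo hi x -> global_minimizer S x.
Proof.
move=> lu cx sx; apply/global_minimizerP => c n y0 hy0.
have [y [sy hy]] := strip_competitor sx hy0; apply: le_trans.
rewrite leNgt; apply/negP => yx.
pose g (w : X) : R := en c n w - en c n (splice (c + r%:Z) (c + n%:Z) w y).
have cg : continuous g.
  apply: (@continuous_sub_fun R X); first exact: continuous_en.
  move=> w; apply: (@continuous_comp X X R); first exact: continuous_splice.
  exact: continuous_en.
have xE : splice (c + r%:Z) (c + n%:Z) x y = y.
  apply/funext => i; rewrite /splice; case: ifP => // hi0.
  by apply: hy; lia.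
pose d := g x / 2.
have gx : 0 < g x by rewrite /g xE subr_gt0.
have d0 : 0 < d by rewrite /d divr_gt0.
have near_d : nbhs x (g @^-1` [set t | d < t]).
  apply: cg; apply: open_nbhs_nbhs; split; first exact: open_gt.
  rewrite /= /d; lra.
(* V: the renormalized energies of all transitions, on all windows *)
pose V := [set v : R | exists a b c k z, [/\ a <= b,
  transition lo hi (a * p%:Z) (b * p%:Z) z, c + r%:Z <= a, b <= c + k%:Z &
  v = ren c k z]].
have Vlb : has_lbound V.
  have [C hC] := renormalized_energy_bound hS hp hlo hhi lohi.
  exists C => _ [a' [b' [c' [k' [z' [ab tz ca bk ->]]]]]].
  exact: hC ab tz ca bk.
have V0 : V !=set0.
  exists (ren (- r%:Z) r (step lo hi 0)); exists 0, 0, (- r%:Z), r, (step lo hi 0).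
  by split; rewrite ?mul0r ?addNr //; split=> i; exact: lexx.
have [_ [a0 [b0 [c0 [k0 [y1 [ab0 ty1 ca0 bk0 ->]]]]]]] :=
  inf_adherent d0 (conj V0 Vlb).
set v0 := inf V => ren_y1.
have [N N1 gN] := cluster_frequently `|(b0 - a0)%R|%N cx near_d.
have [tu minu] := lu N.
pose aN := a N; pose bN := a N + N%:Z.
(* the periods from -B to B contain the transition and the replaced sites *)
pose B := (`|aN| + `|bN| + `|c| + n + r)%N.
pose c1 : int := - (B%:Z + r%:Z); pose k1 := (B + r + B)%N.
have tB : transition lo hi (- B%:Z * p%:Z) (B%:Z * p%:Z) (u N).
  apply: (transition_widen lohi _ _ tu); apply: ler_wpM2r => //;
    rewrite -/aN -/bN /B; lia.
(* the cheaper competitor, moved to the window of the N-th transition *)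
pose s := aN - a0; pose y2 := tau (p%:Z * s) (q * s) y1.
have ty2 : transition lo hi (aN * p%:Z) (bN * p%:Z) y2.
  have := transition_tau (fix_lo hlo s) (fix_hi hhi s) ty1.
  apply: transition_widen => //; first by rewrite /s; lia.
  rewrite [p%:Z * _]mulrC -mulrDl; apply: ler_wpM2r => //.
  rewrite /s /bN /aN; lia.
have Bp : B%:Z <= B%:Z * p%:Z by nia.
have hc1 : c1 * p%:Z + r%:Z <= aN * p%:Z.
  have : (c1 + r%:Z) * p%:Z <= aN * p%:Z.
    by apply: ler_wpM2r => //; rewrite /c1 /B; lia.
  have : r%:Z <= r%:Z * p%:Z by nia.
  lia.
have hk1 : bN * p%:Z <= c1 * p%:Z + (k1 * p)%N%:Z.
  by rewrite PoszM -mulrDl; apply: ler_wpM2r => //; rewrite /c1 /k1 /B; lia.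
have uy2 : ren c1 k1 (u N) <= ren c1 k1 y2.
  by rewrite lerD2r; exact: (minu _ ty2 _ _ hc1 hk1).1.
have : ren c1 k1 y2 = ren c0 k0 y1.
  rewrite /y2 renormalized_energy_tau //.
  apply: (renormalized_energy_window hS hp hlo hhi ab0 ty1) => //.
    by rewrite /s /c1 /B; lia.
  by rewrite /s /c1 /k1 /B; lia.
pose y3 := splice (c + r%:Z) (c + n%:Z) (u N) y.
have ty3 : transition lo hi (- B%:Z * p%:Z) (B%:Z * p%:Z) y3.
  have BB : - B%:Z * p%:Z <= B%:Z * p%:Z by lia.
  have su := transition_strip lohi tu.
  apply: transitionP.
  - split=> i; rewrite /y3 /splice; case: ifP => _.
    + exact: sy.1.
    + exact: su.1.
    + exact: sy.2.
    + exact: su.2.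
  - move=> i iB; rewrite /y3 /splice ifF; last by rewrite /B in Bp iB *; lia.
    exact: transition_left BB tB iB.
  - move=> i iB; rewrite /y3 /splice ifF; last by rewrite /B in Bp iB *; lia.
    exact: transition_right BB tB iB.
have Vy3 : v0 <= ren c1 k1 y3.
  apply: ge_inf => //; exists (- B%:Z), B%:Z, c1, k1, y3; split=> //.
  - by lia.
  - by rewrite /c1; lia.
  - by rewrite /c1 /k1; lia.
have diff : en (c1 * p%:Z) (k1 * p) y3 - en (c1 * p%:Z) (k1 * p) (u N) =
    en c n y3 - en c n (u N).
  apply: en_widen.
  - have cB : - c <= B%:Z by rewrite /B; lia.
    have rp : 0 <= r%:Z * p%:Z by exact: mulr_ge0.
    by rewrite /c1 mulNr mulrDl; clearbody B; lia.
  - rewrite PoszM -mulrDl (_ : c1 + k1%:Z = B%:Z); last by rewrite /c1 /k1; lia.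
    by apply: le_trans Bp; rewrite /B; lia.
  - by move=> i hi0; rewrite /y3 /splice ifF //; lia.
move: gN; rewrite /g -/y3 /=; rewrite /ren in uy2 Vy3 ren_y1 *; lra.
Qed.

End Cluster.

(** * The descending heteroclinic *)

Lemma cvg_slope (R : realType) (f : nat -> R) (rho M : R) :
  (forall n, `|f n - n%:R * rho| <= M) -> (fun n => f n / n%:R) @ \oo --> rho.
Proof.
move=> hf; rewrite -cvg_shiftS.
have lim_up : (fun n => rho + M * @harmonic R n) @ \oo --> rho.
  rewrite -[X in _ --> X]addr0 -[X in _ + X](mulr0 M).
  by apply: cvgD; [exact: cvg_cst | apply: cvgM; [exact: cvg_cst | exact: cvg_harmonic]].
have lim_dn : (fun n => rho - M * @harmonic R n) @ \oo --> rho.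
  rewrite -[X in _ --> X]subr0 -[X in _ - X](mulr0 M).
  by apply: cvgB; [exact: cvg_cst | apply: cvgM; [exact: cvg_cst | exact: cvg_harmonic]].
apply: squeeze_cvgr lim_dn lim_up; apply: nearW => n /=.
have n0 : 0 < n.+1%:R :> R by rewrite ltr0n.
have := hf n.+1; rewrite ler_norml /harmonic /= => /andP[h1 h2].
rewrite ler_pdivlMr // ler_pdivrMr // mulrBl mulrDl -mulrA mulVf ?mulr1; last first.
  by rewrite gt_eqF.
by apply/andP; split; lra.
Qed.

Section Heteroclinic.
Variables (R : realType) (r : nat) (S : 'rV[R]_r.+1 -> R).
Hypothesis hS : lattice_energy S.
Variables (p : nat) (q : int).
Hypothesis hp : (0 < p)%N.
Variables lo hi : zseq R.
Hypothesis hlo : pq_minimizers S p q lo.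
Hypothesis hhi : pq_minimizers S p q hi.
Hypothesis lohi : lt_seq lo hi.
Hypothesis hgap : ~ exists y : zseq R,
  [/\ pq_minimizers S p q y, lt_seq lo y & lt_seq y hi].
Implicit Types (x y z u w : zseq R) (a b c s : int) (n m k : nat).
Local Notation en := (window_energy S).
Local Notation X := {ptws int -> R}.

Lemma strip_rotation_number x : strip lo hi x ->
  has_rotation_number x (q%:~R / p%:R).
Proof.
move=> [lox xhi]; set rho := _ / _.
have bounded z : tau p%:Z q z = z ->
    exists M : R, forall i : int, `|z i - i%:~R * rho| <= M.
  move=> pz; apply: (@periodic_bounded R (fun i => z i - i%:~R * rho) p) => // i.
  rewrite -[in LHS]pz /tau addrK intrD mulrDl.
  have -> : (p%:Z)%:~R * rho = q%:~R by rewrite -pmulrn mulrC divfK // pnatr_eq0; lia.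
  ring.
have [M1 hM1] := bounded lo hlo.1; have [M2 hM2] := bounded hi hhi.1.
have hx i : `|x i - i%:~R * rho| <= M1 + M2.
  have := hM1 i; have := hM2 i; rewrite !ler_norml.
  by have := lox i; have := xhi i; lra.
split.
  by apply: (@cvg_slope _ _ _ (M1 + M2)) => n; exact: hx.
have -> : (fun n : nat => x (- n%:Z) / (- n%:R)) = (fun n => - x (- n%:Z) / n%:R).
  by apply/funext => n; rewrite invrN mulrN mulNr.
apply: (@cvg_slope _ _ _ (M1 + M2)) => n; rewrite -normrN.
by have := hx (- n%:Z); rewrite mulrNz mulNr opprD !opprK.
Qed.

(** A translation maps [lo] to a p-q-minimizer.  If that is different from
    [lo], the gap moves the whole strip to one side of itself; otherwise the
    translation fixes [lo] and [hi] and the monotonicity hypothesis, for it or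
    for its inverse, compares the sequences. *)
Lemma strip_birkhoff x : strip lo hi x ->
  (forall k l : int, 0 <= k -> tau k l lo = lo -> tau k l hi = hi ->
     le_seq (tau k l x) x) ->
  birkhoff x.
Proof.
move=> [lox xhi] mono k l.
have gap z (k' l' : int) (hz : pq_minimizers S p q z) :=
  gap_total hS hp hlo hhi lohi hgap (pq_minimizers_tau hS k' l' hz).
have [h1|h1] := gap _ k l hlo; last first.
  right; apply: le_seq_trans xhi (le_seq_trans h1 _); exact: le_tau.
have [h2|h2] := gap _ (- k) (- l) hlo; last first.
  left; apply: (@le_seq_trans _ _ lo) => //; apply/le_tauP.
  exact: le_seq_trans xhi h2.
have tlo : tau k l lo = lo.
  by apply: le_seq_anti => //; rewrite -{1}(tauK k l lo); exact: le_tau.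
have big (k' l' : int) : tau k' l' lo = lo -> le_seq hi (tau k' l' hi).
  move=> tl; have [h|//] := gap _ k' l' hhi.
  have := h 0; rewrite -{1}tl /tau lerD2r => h0.
  by have := lohi (0 - k'); rewrite ltNge h0.
have thi : tau k l hi = hi.
  apply: le_seq_anti; last exact: big.
  apply/le_tauP; apply: big; exact: tau_fixV.
have [k0|k0] := lerP 0 k; first by left; exact: mono.
right; have := mono (- k) (- l) _ (tau_fixV tlo) (tau_fixV thi).
by move=> /(_ ltac:(lia)) /le_tauP; rewrite !opprK.
Qed.

Lemma closed_strip : closed (strip lo hi).
Proof.
have -> : strip lo hi = \bigcap_(i in [set: int])
    ([set x : X | lo i <= x i] `&` [set x : X | x i <= hi i]).
  apply/seteqP; split=> [x [h1 h2] i _|x h]; first by split=> /=.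
  by split=> i; have [] := h i I.
apply: closed_bigI => i _; apply: closedI; apply: closed_le_fun;
  by [exact: cst_continuous | exact: continuous_coord].
Qed.

(** The pointwise limit is fixed by the translation and is a global minimizer,
    hence a p-q-minimizer, and the gap leaves only its two ends.  The sign [s]
    covers both directions of time. *)
Lemma orbit_limit (s : int) x : s * s = 1 ->
  strip lo hi x -> global_minimizer S x ->
  (forall i, cvgn (fun n : nat => tau (p%:Z * (s * n%:Z)) (q * (s * n%:Z)) x i)) ->
  exists2 z, z = lo \/ z = hi & forall i,
    (fun n : nat => tau (p%:Z * (s * n%:Z)) (q * (s * n%:Z)) x i) @ \oo --> z i.
Proof.
move=> ss sx gx cx.
pose u (n : nat) : X := tau (p%:Z * (s * n%:Z)) (q * (s * n%:Z)) x.
pose z : X := fun i => lim ((fun n => u n i) @ \oo).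
have uz i : (fun n => u n i) @ \oo --> z i by exact: cx.
have uzX : u @ \oo --> z by apply: cvg_pointwise.
have uS n : u n.+1 = tau (p%:Z * s) (q * s) (u n).
  by rewrite /u tau_add; congr (tau _ _ x); rewrite -mulrDr; congr (_ * _); lia.
have closed_lim (A : set X) : closed A -> (forall n, A (u n)) -> A z.
  move=> cA hA; refine (@closed_cvg _ _ _ _ u A cA _ z uzX).
  exact: nearW.
have sz : strip lo hi z.
  apply: closed_lim; first exact: closed_strip.
  by move=> n; exact: (strip_tau hlo hhi _ sx).
have gz : global_minimizer S z.
  apply: (closed_lim _ (closed_global_minimizer hS)) => n /=.
  exact: global_minimizer_tau.
have tz' : tau (p%:Z * s) (q * s) z = z.
  apply/funext => i; rewrite /tau.
  have h1 : (fun n => u n.+1 i) @ \oo --> z i.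
    by have := uz i; rewrite -(cvg_shiftS (fun n => u n i)).
  have h2 : (fun n => u n.+1 i) @ \oo --> z (i - p%:Z * s) + (q * s)%:~R.
    have -> : (fun n => u n.+1 i) = fun n => u n (i - p%:Z * s) + (q * s)%:~R.
      by apply/funext => n; rewrite uS.
    by apply: cvgD; [exact: uz | exact: cvg_cst].
  exact: cvg_unique h2 h1.
have tz : tau p%:Z q z = z.
  by have := tau_fixM s tz'; rewrite -!mulrA ss !mulr1.
exists z; last exact: uz.
apply: (gap_between hS hp hlo hhi hgap) => //; [|exact: sz.1|exact: sz.2].
exact: (global_periodic_pq_minimizer hS hp hlo hhi).
Qed.

(** Follow the least transition on n periods along the multiples of the
    period, in the moving frame: it is below [mid] before the window and above
    it after, so there is a first multiple at which it is above; this one is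
    moved to the site 0. *)
Lemma centered_transition (mid : R) n : lo 0 < mid -> mid <= hi 0 ->
  exists a x, [/\ least_transition S lo hi (a * p%:Z) ((a + n%:Z) * p%:Z) x,
    mid <= x 0 & x (- p%:Z) + q%:~R <= mid].
Proof.
move=> lomid midhi.
have [w lw] : exists w, least_transition S lo hi 0 (n%:Z * p%:Z) w.
  by apply: least_transition_exists; rewrite // mulr_ge0.
pose above (j : nat) := mid <= w (j%:Z * p%:Z) - (q * j%:Z)%:~R.
have np0 : 0 <= n%:Z * p%:Z by rewrite mulr_ge0.
have above_n : above n.
  rewrite /above (transition_right np0 lw.1) //.
  have <- : tau (p%:Z * n%:Z) (q * n%:Z) hi (n%:Z * p%:Z) = hi (n%:Z * p%:Z).
    by rewrite (fix_hi hhi).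
  by rewrite /tau addrK mulrC subrr.
have [j abj minj] := ex_minnP (ex_intro above n above_n).
exists (- j%:Z), (tau (p%:Z * - j%:Z) (q * - j%:Z) w); split.
- have := least_transition_tau hS (fix_lo hlo (- j%:Z)) (fix_hi hhi (- j%:Z)) lw.
  have -> : 0 + p%:Z * - j%:Z = - j%:Z * p%:Z by ring.
  by have -> : n%:Z * p%:Z + p%:Z * - j%:Z = (- j%:Z + n%:Z) * p%:Z by ring.
- move: abj; rewrite /tau /above.
  have -> : 0 - p%:Z * - j%:Z = j%:Z * p%:Z by ring.
  by rewrite mulrN mulrNz.
- rewrite /tau; case: j abj minj => [|j] _ minj.
    rewrite oppr0 !mulr0 subr0 mulr0z addr0 (transition_left np0 lw.1); last by lia.
    have : tau p%:Z q lo 0 = lo 0 by rewrite hlo.1.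
    by rewrite /tau sub0r => ->; exact: ltW.
  rewrite leNgt; apply/negP => lt_mid.
  have : above j.
    rewrite /above; apply: ltW; apply: lt_le_trans lt_mid _.
    have -> : - p%:Z - p%:Z * - j.+1%:Z = j%:Z * p%:Z by lia.
    have -> : q * - j.+1%:Z = - (q * j%:Z) - q by lia.
    by rewrite intrD mulrNz mulrNz; lra.
  by move/minj; rewrite ltnn.
Qed.

Theorem descending_heteroclinic : exists x : zseq R,
  [/\ (BMminus S p q `\` pq_minimizers S p q) x,
      lim_pinfty (fun n : int => tau_pow p%:Z q n x) lo &
      lim_minfty (fun n : int => tau_pow p%:Z q n x) hi].
Proof.
pose mid : R := (lo 0 + hi 0) / 2.
have lomid : lo 0 < mid by have := lohi 0; rewrite /mid; lra.
have midhi : mid < hi 0 by have := lohi 0; rewrite /mid; lra.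
have [f hf] : {f : nat -> int * zseq R & forall n,
    [/\ least_transition S lo hi ((f n).1 * p%:Z) (((f n).1 + n%:Z) * p%:Z) (f n).2,
      mid <= (f n).2 0 & (f n).2 (- p%:Z) + q%:~R <= mid]}.
  apply: (@choice _ _ (fun n (ax : int * zseq R) =>
    [/\ least_transition S lo hi (ax.1 * p%:Z) ((ax.1 + n%:Z) * p%:Z) ax.2,
      mid <= ax.2 0 & ax.2 (- p%:Z) + q%:~R <= mid])) => n.
  have [a [x h]] := centered_transition n lomid (ltW midhi).
  by exists (a, x).
pose u (n : nat) : X := (f n).2.
have su n : strip lo hi (u n).
  have [[tu _] _ _] := hf n; exact (transition_strip lohi tu).
have cI : compact (strip lo hi) by exact: compact_order_interval.
have Fstrip : (u @ \oo) (strip lo hi) by exists 0%N => // n _; exact: su.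
have [x [sx cx]] := cI (u @ \oo) _ Fstrip.
have gx : global_minimizer S x.
  apply: (cluster_global_minimizer hS hp hlo hhi lohi (u := u) (a := fun n => (f n).1)) => //.
  by move=> n; have [] := hf n.
have mono (k l : int) : 0 <= k -> tau k l lo = lo -> tau k l hi = hi ->
    le_seq (tau k l x) x.
  move=> k0 tlo thi i.
  have cC : closed [set y : X | y (i - k) + l%:~R <= y i].
    apply: closed_le_fun; last exact: continuous_coord.
    apply: (@continuous_add_fun R X); first exact: continuous_coord.
    exact: cst_continuous.
  apply: (cluster_closed cx cC) => n; have [lu _ _] := hf n.
  apply: (least_transition_monotone hS lohi _ k0 tlo thi lu).
  by apply: ler_wpM2r => //; lia.
have midx : mid <= x 0.
  apply: (cluster_closed (C := [set y : X | mid <= y 0]) cx).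
    by apply: closed_le_fun; [exact: cst_continuous | exact: continuous_coord].
  by move=> n; have [] := hf n.
have xmid : x (- p%:Z) + q%:~R <= mid.
  apply: (cluster_closed (C := [set y : X | y (- p%:Z) + q%:~R <= mid]) cx).
    apply: closed_le_fun; last exact: cst_continuous.
    apply: (@continuous_add_fun R X); first exact: continuous_coord.
    exact: cst_continuous.
  by move=> n; have [] := hf n.
have tx : le_seq (tau p%:Z q x) x by apply: mono; rewrite ?hlo.1 ?hhi.1.
(* If x were periodic, the two inequalities at the site 0 would force x 0 = mid,
   strictly between the only two candidates lo and hi. *)
have npq : ~ pq_minimizers S p q x.
  move=> hx.
  have x0 : x 0 = mid.
    apply/eqP; rewrite eq_le midx andbT; have := hx.1; rewrite /periodic_seqs /= => hx1.
    by rewrite -[x in x 0]hx1 /tau sub0r.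
  have [xE|xE] := gap_between hS hp hlo hhi hgap hx sx.1 sx.2;
    by move: lomid midhi; rewrite -x0 xE ltxx.
have orbit (s : int) (n : nat) : strip lo hi (tau (p%:Z * (s * n%:Z)) (q * (s * n%:Z)) x).
  exact (strip_tau hlo hhi _ sx).
have step (m : int) : le_seq (tau (p%:Z * (m + 1)) (q * (m + 1)) x)
    (tau (p%:Z * m) (q * m) x).
  by rewrite !mulrDr !mulr1 -tau_add; exact: le_tau.
exists x; split.
- split=> //; split=> //; split.
    exact: strip_birkhoff.
  exact: strip_rotation_number.
- have noninc i : nonincreasing_seq
      (fun n : nat => tau (p%:Z * (1 * n%:Z)) (q * (1 * n%:Z)) x i).
    apply/nonincreasing_seqP => n; have := step n%:Z i.
    by rewrite !mul1r (_ : n%:Z + 1 = n.+1%:Z) //; lia.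
  have [i|z [->|->] hz] := orbit_limit (s := 1) (mulr1 1) sx gx.
  + apply: nonincreasing_is_cvgn => //.
    exists (lo i) => _ [n _ <-]; exact: (orbit 1 n).1.
  + by move=> i; have := hz i; under eq_fun do rewrite mul1r -tau_powE.
  + suff : hi 0 <= mid by rewrite leNgt midhi.
    refine (@closed_cvg _ R _ _ _ _ (@closed_le R mid) _ _ (hz 0)).
    exists 1%N => // n /= n1; apply: le_trans (noninc 0 _ _ n1) _.
    by rewrite /= !mulr1 /tau sub0r.
- have nondec i : nondecreasing_seq
      (fun n : nat => tau (p%:Z * (- 1 * n%:Z)) (q * (- 1 * n%:Z)) x i).
    apply/nondecreasing_seqP => n; have := step (- n.+1%:Z) i.
    by rewrite !mulN1r (_ : - n.+1%:Z + 1 = - n%:Z) //; lia.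
  have [i|z [->|->] hz] := orbit_limit (s := - 1) (mulrNN 1 1) sx gx.
  + apply: nondecreasing_is_cvgn => //.
    exists (hi i) => _ [n _ <-]; exact: (orbit (- 1) n).2.
  + suff : mid <= lo 0 by rewrite leNgt lomid.
    refine (@closed_cvg _ R _ _ _ _ (@closed_ge R mid) _ _ (hz 0)).
    exists 0%N => // n /= n1; apply: le_trans midx (le_trans _ (nondec 0 _ _ n1)).
    by rewrite /= !mulr0 tau0.
  + by move=> i; have := hz i; under eq_fun do rewrite mulN1r -tau_powE.
Qed.
End Heteroclinic.

(** * Reflection *)

Section Reflection.
Variables (R : realType) (r : nat).
Implicit Types (S : 'rV[R]_r.+1 -> R) (x y z : zseq R).

Definition reflect_seq x : zseq R := fun i => - x i.

(** Under [x |-> -x] the order is reversed and the rotation number changes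
    sign; the energy of the reflected sequences is again a lattice energy. *)
Definition reflect_energy S : 'rV[R]_r.+1 -> R := fun xi => S (- xi).

Local Notation neg := reflect_seq.
Local Notation Sneg := reflect_energy.

Lemma reflect_seqK x : neg (neg x) = x.
Proof. by apply/funext => i; rewrite /neg opprK. Qed.

Lemma reflect_energyK S : Sneg (Sneg S) = S.
Proof. by apply/funext => xi; rewrite /Sneg opprK. Qed.

Lemma reflect_tau k l x : tau k (- l) (neg x) = neg (tau k l x).
Proof. by apply/funext => i; rewrite /tau /neg mulrNz opprD. Qed.

Lemma reflect_le x y : le_seq (neg x) (neg y) <-> le_seq y x.
Proof. by split=> h i; have := h i; rewrite /neg lerN2. Qed.

Lemma reflect_min x y : neg (seq_min x y) = seq_max (neg x) (neg y).
Proof. by apply/funext => i; rewrite /neg /seq_min /seq_max oppr_min. Qed.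

Lemma reflect_max x y : neg (seq_max x y) = seq_min (neg x) (neg y).
Proof. by apply/funext => i; rewrite /neg /seq_min /seq_max oppr_max. Qed.

Lemma reflect_shiftS S i x : shiftS (Sneg S) i x = shiftS S i (neg x).
Proof.
by rewrite /shiftS /Sneg; congr (S _); apply/rowP => j; rewrite !mxE.
Qed.

Lemma reflect_window_energy S c n x :
  window_energy (Sneg S) c n x = window_energy S c n (neg x).
Proof. by apply: eq_bigr => i _; exact: reflect_shiftS. Qed.

Lemma reflect_global_minimizer S x :
  global_minimizer S (neg x) -> global_minimizer (Sneg S) x.
Proof.
move=> /global_minimizerP h; apply/global_minimizerP => c n y hy.
rewrite !reflect_window_energy; apply: h => i hi.
by rewrite /neg hy.
Qed.

Lemma reflect_global_minimizerN S x :
  global_minimizer (Sneg S) x -> global_minimizer S (neg x).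
Proof.
move=> h; rewrite -(reflect_energyK S); apply: reflect_global_minimizer.
by rewrite reflect_seqK.
Qed.

Lemma reflect_lattice_energy S : lattice_energy S -> lattice_energy (Sneg S).
Proof.
move=> [cS pS subS touchS]; split.
- move=> xi; apply: (@continuous_comp _ _ _ (fun xi : 'rV[R]_r.+1 => - xi) S).
    exact: oppr_continuous.
  exact: cS.
- move=> xi; rewrite /Sneg -[LHS]pS; congr (S _).
  by rewrite opprD subrK.
- move=> i x y; rewrite !reflect_shiftS reflect_min reflect_max addrC.
  exact: subS.
- move=> x y i gx gy xy e; rewrite -(reflect_seqK x) -(reflect_seqK y); congr neg.
  apply/esym; apply: (touchS _ _ i); [exact: reflect_global_minimizerN..| |].
    by apply/reflect_le.
  by rewrite /neg e.
Qed.

Lemma reflect_pq_minimizers S p q x :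
  pq_minimizers S p q (neg x) -> pq_minimizers (Sneg S) p (- q) x.
Proof.
move=> [px mx]; split=> [|y py].
  by rewrite /periodic_seqs /= -{1}(reflect_seqK x) reflect_tau px reflect_seqK.
rewrite !periodic_energyE !reflect_window_energy -!periodic_energyE.
apply: mx; move: py; rewrite /periodic_seqs /= => py.
by rewrite -[q]opprK reflect_tau py.
Qed.

Lemma reflect_pq_minimizersN S p q x :
  pq_minimizers (Sneg S) p (- q) x -> pq_minimizers S p q (neg x).
Proof.
move=> h; rewrite -(reflect_energyK S) -[q]opprK.
by apply: reflect_pq_minimizers; rewrite reflect_seqK.
Qed.

Lemma reflect_birkhoff x : birkhoff x -> birkhoff (neg x).
Proof.
move=> h k l; rewrite -[l]opprK reflect_tau.
have [h1|h1] := h k (- l); first by right; apply/reflect_le.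
by left; apply/reflect_le.
Qed.

Lemma reflect_rotation_number x nu :
  has_rotation_number x nu -> has_rotation_number (neg x) (- nu).
Proof.
move=> [h1 h2]; split.
  have -> : (fun n : nat => neg x n%:Z / n%:R) = fun n : nat => - (x n%:Z / n%:R).
    by apply/funext => n; rewrite /neg mulNr.
  exact: cvgN.
have -> : (fun n : nat => neg x (- n%:Z) / (- n%:R)) =
    fun n : nat => - (x (- n%:Z) / (- n%:R)).
  by apply/funext => n; rewrite /neg mulNr.
exact: cvgN.
Qed.

Theorem ascending_heteroclinic S (p : nat) (q : int) (lo hi : zseq R) :
  lattice_energy S -> (0 < p)%N ->
  pq_minimizers S p q lo -> pq_minimizers S p q hi -> lt_seq lo hi ->
  ~ (exists y, [/\ pq_minimizers S p q y, lt_seq lo y & lt_seq y hi]) ->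
  exists x : zseq R,
  [/\ (BMplus S p q `\` pq_minimizers S p q) x,
      lim_pinfty (fun n => tau_pow p%:Z q n x) hi &
      lim_minfty (fun n => tau_pow p%:Z q n x) lo].
Proof.
move=> hS hp hlo hhi lohi hgap.
have hlo' : pq_minimizers (Sneg S) p (- q) (neg lo).
  by apply: reflect_pq_minimizers; rewrite reflect_seqK.
have hhi' : pq_minimizers (Sneg S) p (- q) (neg hi).
  by apply: reflect_pq_minimizers; rewrite reflect_seqK.
have [] := descending_heteroclinic (reflect_lattice_energy hS) hp hhi' hlo'.
- by move=> i; rewrite /neg ltrN2.
- move=> [y [hy y1 y2]]; apply: hgap; exists (neg y); split.
  + exact: reflect_pq_minimizersN.
  + by move=> i; rewrite /neg -[lo i]opprK ltrN2; exact: y2.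
  + by move=> i; rewrite /neg -[hi i]opprK ltrN2; exact: y1.
move=> x [[[gx [bx rx] tx] nx] l1 l2]; exists (neg x).
have powE n : tau_pow p%:Z q n (neg x) = neg (tau_pow p%:Z (- q) n x).
  by rewrite !tau_powE mulNr -reflect_tau opprK.
split.
- split; last by move=> h; apply: nx; exact: reflect_pq_minimizers.
  split; first exact: reflect_global_minimizerN.
    split; first exact: reflect_birkhoff.
    by rewrite -[_ / _]opprK -mulNr -mulrNz; exact: reflect_rotation_number.
  by rewrite -[q]opprK reflect_tau; apply/reflect_le.
- move=> i; under eq_fun do rewrite powE.
  by rewrite -[hi i]opprK; apply: cvgN; exact: l1.
- move=> i; under eq_fun do rewrite powE.
  by rewrite -[lo i]opprK; apply: cvgN; exact: l2.
Qed.

End Reflection.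

(** * Second-order calculus along coordinate lines *)

Section Slices.
Variable R : realType.

(** Only increments of [g] matter, so that [g] may contain terms that are
    constant along the line. *)
Lemma derivable_slice n (F : 'rV[R]_n.+1 -> R) (X v : 'rV[R]_n.+1)
    (g : R -> R) (t : R) :
  (forall h, g (h + t) - g t = F (h *: v + X) - F X) ->
  derivable F X v -> derivable g t 1 /\ derive1 g t = 'D_v F X.
Proof.
move=> gF dF.
have e : (fun h => h^-1 *: (g (h + t) - g t)) =
    (fun h => h^-1 *: ((F \o shift X) (h *: v) - F X)).
  by apply/funext => h; rewrite gF.
split; last by rewrite /derive1 e.
rewrite /derivable.
have -> : (fun h => h^-1 *: ((g \o shift t) (h *: 1) - g t)) =
    (fun h => h^-1 *: (g (h + t) - g t)).
  by apply/funext => h /=; rewrite [h *: 1]mulr1.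
by rewrite e.
Qed.

Lemma mean_value (g : R -> R) (a b : R) : (forall t, derivable g t 1) ->
  a <= b -> exists c, g b - g a = derive1 g c * (b - a).
Proof.
move=> dg ab; have [|//|c _ ->] := @MVT_segment R g (derive1 g) a b ab.
- by move=> x _; rewrite derive1E; exact: derivableP.
- exact: derivable_within_continuous.
- by exists c.
Qed.

Lemma pt2_shift1 (s t h : R) :
  pt2 (h + s) t = h *: delta_mx ord0 ord0 + pt2 s t.
Proof.
apply/rowP => -[[|[|//]] i]; rewrite !mxE -!val_eqE /=; first by rewrite mulr1.
by rewrite mulr0 add0r.
Qed.

Lemma pt2_shift2 (s t h : R) :
  pt2 s (h + t) = h *: delta_mx ord0 (lift ord0 ord0) + pt2 s t.
Proof.
apply/rowP => -[[|[|//]] i]; rewrite !mxE -!val_eqE /=; last by rewrite mulr1.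
by rewrite mulr0 add0r.
Qed.

(** The integrated form of the bound on the mixed derivative, by the mean
    value theorem in each variable. *)
Lemma rectangle_inequality (F : 'rV[R]_2 -> R) (kappa a a' b b' : R) :
  C2 F ->
  (forall s t, derive1 (fun s' => partial (lift ord0 ord0) F (pt2 s' t)) s <= - kappa) ->
  a <= a' -> b <= b' ->
  F (pt2 a' b') + F (pt2 a b) + kappa * (a' - a) * (b' - b) <=
  F (pt2 a b') + F (pt2 a' b).
Proof.
move=> [_ dF _ ddF _] mixed aa bb.
have col s t : derivable (fun t => F (pt2 s t)) t 1 /\
    derive1 (fun t => F (pt2 s t)) t = partial (lift ord0 ord0) F (pt2 s t).
  by apply: derivable_slice; [move=> h; rewrite pt2_shift2 | exact: dF].
(* first in the second variable, for the increment in the first one *)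
pose psi t := F (pt2 a' t) - F (pt2 a t).
have dpsi t : derivable psi t 1.
  by apply: derivableB; [exact: (col a' t).1 | exact: (col a t).1].
have [tau_ psiE] := mean_value dpsi bb.
have row s : derivable (fun s' => partial (lift ord0 ord0) F (pt2 s' tau_)) s 1.
  apply: (derivable_slice _ (ddF ord0 (lift ord0 ord0) (pt2 s tau_))).1.
  by move=> h; rewrite pt2_shift1.
have [xi rowE] := mean_value row aa.
have psi' : derive1 psi tau_ <= - kappa * (a' - a).
  have -> : derive1 psi tau_ = partial (lift ord0 ord0) F (pt2 a' tau_) -
      partial (lift ord0 ord0) F (pt2 a tau_).
    rewrite derive1E deriveB; [|exact: (col a' tau_).1|exact: (col a tau_).1].
    by rewrite -!derive1E (col a' tau_).2 (col a tau_).2.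
  by rewrite rowE ler_wpM2r ?subr_ge0 ?mixed.
have : derive1 psi tau_ * (b' - b) <= - kappa * (a' - a) * (b' - b).
  by rewrite ler_wpM2r // subr_ge0.
by rewrite -psiE /psi; lra.
Qed.

(** If the slope to the right of the minimum were at least [kappa], the
    function minus [kappa / 2] times the identity would have a minimum at the
    same point, and both derivatives would vanish there. *)
Lemma no_kink (G : R -> R) (kappa t0 : R) : 0 < kappa ->
  (forall t, derivable G t 1) -> (forall t, G t0 <= G t) ->
  (forall t, t0 < t -> G t0 + kappa * (t - t0) <= G t) -> False.
Proof.
move=> k0 dG G0 Gk.
pose H (t : R) := G t - kappa / 2 * t.
have dlin t : derivable (fun t : R => kappa / 2 * t) t 1.
  by apply: derivableM; [exact: derivable_cst | exact: derivable_id].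
have dH t : derivable H t 1 by apply: derivableB.
have H0 t : H t0 <= H t.
  rewrite /H; have [tt|tt] := ltrP t0 t.
    have kt : 0 < kappa * (t - t0) by rewrite mulr_gt0 ?subr_gt0.
    by have := Gk t tt; lra.
  have kt : kappa * (t - t0) <= 0 by rewrite mulr_ge0_le0 ?subr_le0 // ltW.
  by have := G0 t; lra.
have in0 : t0 \in `](t0 - 1), (t0 + 1)[.
  by rewrite in_itv /= ltrBlDr ltrDl ltr01.
have le11 : t0 - 1 <= t0 + 1 by lra.
have [_ G'] := derive1_at_min le11 (fun t _ => dG t) in0 (fun t _ => G0 t).
have [_ H'] := derive1_at_min le11 (fun t _ => dH t) in0 (fun t _ => H0 t).
move: H'; rewrite deriveB // G' deriveM ?derive_cst ?derive_id; last first.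
- exact: derivable_id.
- exact: derivable_cst.
rewrite scaler0 addr0 sub0r => /eqP; rewrite oppr_eq0 [_ *: _]mulr1.
by move/eqP; lra.
Qed.

End Slices.

(** * Weak twist implies the lattice properties *)

Section WeakTwist.
Variables (R : realType) (r : nat) (K lambda : R).
Hypothesis hr : (1 <= r)%N.
Hypothesis hlambda : 0 < lambda.
Variable S : 'rV[R]_r.+1 -> R.
Hypothesis hS : weak_twist_energy K lambda S.

Let kappa (j : 'I_r) : R := if (j : nat) == 0%N then lambda else 0.

(** The mixed derivative of a local energy in its first and (j+1)-st site is
    that of the j-th pair potential alone.  The nearest-neighbour pair has the
    strict constant [lambda]. *)
Lemma weak_twist_pairs : exists f : 'I_r -> 'rV[R]_2 -> R,
  [/\ forall i (x : zseq R), shiftS S i x =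
        \sum_(j < r) f j (pt2 (x i) (x (i + j.+1%:Z))),
      forall j nu mu, f j (pt2 (nu + 1) (mu + 1)) = f j (pt2 nu mu) &
      forall j a a' b b', a <= a' -> b <= b' ->
        f j (pt2 a' b') + f j (pt2 a b) + kappa j * (a' - a) * (b' - b) <=
        f j (pt2 a b') + f j (pt2 a' b)].
Proof.
have [_ [[f [SE hf]] [tw0 tw1]]] := hS; exists f.
have shiftE i (x : zseq R) : shiftS S i x =
    \sum_(j < r) f j (pt2 (x i) (x (i + j.+1%:Z))).
  rewrite /shiftS SE; apply: eq_bigr => j _; rewrite !mxE /= addr0.
  by rewrite /bump leq0n add1n.
split=> [//|j nu mu|j a a' b b']; first by have [_ ->] := hf j.
have [C2f _ _ _] := hf j; apply: rectangle_inequality => // s t.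
pose e1 : 'I_2 := lift ord0 ord0.
have inner (x : zseq R) : partial_seq j.+1%:Z (shiftS S 0) x =
    partial e1 (f j) (pt2 (x 0) (x j.+1%:Z)).
  have [_ df _ _ _] := C2f.
  refine (derivable_slice _ (df e1 (pt2 (x 0) (x j.+1%:Z)))).2 => h.
  rewrite -pt2_shift2 !shiftE (bigD1 j) //= [in X in _ - X](bigD1 j) //=.
  rewrite /update !add0r eqxx /= opprD addrACA -sumrB big1 ?addr0 //.
  move=> j' jj'; have -> : (j'.+1%:Z == j.+1%:Z :> int) = false.
    by apply/negbTE; apply: contra jj' => /eqP [e]; apply/eqP/val_inj.
  by rewrite subrr.
(* any sequence with these values at the two sites of the pair will do *)
pose x : zseq R := fun k => if k == 0 then s else t.
have <- : partial_seq 0 (partial_seq j.+1%:Z (shiftS S 0)) x =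
    derive1 (fun s' => partial e1 (f j) (pt2 s' t)) s.
  rewrite {1}/partial_seq; have -> : x 0 = s by [].
  by congr (derive1 _ s); apply/funext => s'; rewrite inner.
rewrite /kappa; case: eqP => [j0|_].
  by rewrite j0; have := tw1 0 x; rewrite add0r => /ltW.
by rewrite oppr0; apply: tw0.
Qed.

Lemma derivable_update (k i : int) (x : zseq R) (t : R) :
  derivable (fun t => shiftS S k (update x i t)) t 1.
Proof.
have [[_ dS _ _ _] _] := hS.
have [ik|nik] := boolP (k <= i <= k + r%:Z); last first.
  have -> : (fun t => shiftS S k (update x i t)) = cst (shiftS S k x).
    apply/funext => s; apply: shiftS_local => j hj.
    by rewrite /update; case: eqP => // ji; move: nik; rewrite -ji hj.
  exact: derivable_cst.
have mr : (`|(i - k)%R| < r.+1)%N by lia.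
pose X : 'rV[R]_r.+1 := \row_(m < r.+1) update x i t (k + (m : nat)%:Z).
apply: (derivable_slice _ (dS (Ordinal mr) X)).1 => h.
rewrite /shiftS; congr (S _ - _); apply/rowP => m; rewrite !mxE /update.
rewrite -!val_eqE /=; case: eqP => [ki|ki].
  have -> : (m == `|(i - k)%R|%N :> nat) by apply/eqP; lia.
  by rewrite mulr1.
have -> : (m == `|(i - k)%R|%N :> nat) = false by apply/eqP; lia.
by rewrite mulr0 add0r.
Qed.

(** Raise the common value of [x] and [y] at the site [i] to [t].  By
    submodularity this costs less for the upper sequence [y] than for [x], and
    by [strict] the difference is at least [eta * (t - x i)].  The cost for
    [y] is nonnegative, so the cost for [x] is at least [eta * (t - x i)],
    which contradicts that the derivative of the energy of [x] with respect to
    the site [i] vanishes. *)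
Lemma touching_contradiction (k i : int) (x y : zseq R) (eta : R) :
  (forall k' u v, shiftS S k' (seq_min u v) + shiftS S k' (seq_max u v) <=
    shiftS S k' u + shiftS S k' v) ->
  global_minimizer S x -> global_minimizer S y ->
  le_seq x y -> x i = y i -> i - r%:Z <= k <= i -> 0 < eta ->
  (forall t, x i < t ->
    shiftS S k (update y i t) + shiftS S k x + eta * (t - x i) <=
    shiftS S k (update x i t) + shiftS S k y) -> False.
Proof.
move=> sub gx gy xy xyi ki eta0 strict.
pose c := i - r%:Z.
pose G t := window_energy S c r.+1 (update x i t).
have min_at z t : global_minimizer S z ->
    window_energy S c r.+1 z <= window_energy S c r.+1 (update z i t).
  move=> /global_minimizerP; apply => j hj; rewrite /update ifF //.
  by apply/eqP; rewrite /c in hj; lia.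
have update_id (z : zseq R) : update z i (z i) = z.
  by apply/funext => j; rewrite /update; case: eqP => // ->.
apply: (@no_kink R G eta (x i)) => // [t|t|t t0].
- rewrite /G /window_energy; elim: r.+1 => [|n IH].
    have -> : (fun t => \sum_(0 <= m < 0) shiftS S (c + m%:Z) (update x i t))
        = cst 0 by apply/funext => s; rewrite big_geq.
    exact: derivable_cst.
  have -> : (fun t => \sum_(0 <= m < n.+1) shiftS S (c + m%:Z) (update x i t))
      = (fun t => \sum_(0 <= m < n) shiftS S (c + m%:Z) (update x i t)) +
        (fun t => shiftS S (c + n%:Z) (update x i t)).
    by apply/funext => s; rewrite big_nat_recr.
  by apply: derivableD => //; exact: derivable_update.
- by rewrite /G update_id; exact: min_at.
- have lattice j : seq_min (update x i t) y j = x j /\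
      seq_max (update x i t) y j = update y i t j.
    rewrite /seq_min /seq_max /update; case: eqP => [->|_].
      by rewrite -xyi; split; [apply: min_r | apply: max_l]; exact: ltW.
    by split; [apply: min_l | apply: max_r]; exact: xy.
  have meetE : seq_min (update x i t) y = x.
    by apply/funext => j; have [] := lattice j.
  have joinE : seq_max (update x i t) y = update y i t.
    by apply/funext => j; have [] := lattice j.
  have kr : (`|(k - c)%R| < r.+1)%N by rewrite /c; lia.
  have kE : c + `|(k - c)%R|%N%:Z = k by rewrite /c; lia.
  have total : window_energy S c r.+1 (update y i t) +
      window_energy S c r.+1 x + eta * (t - x i) <=
      window_energy S c r.+1 (update x i t) + window_energy S c r.+1 y.
    rewrite /window_energy !big_mkord -!big_split /=.
    rewrite (bigD1 (Ordinal kr)) //= [leRHS](bigD1 (Ordinal kr)) //= kE.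
    rewrite [leLHS]addrAC; apply: lerD.
      exact: strict.
    apply: ler_sum => m _; rewrite addrC -{1}meetE -joinE; exact: sub.
  by have := min_at y t gy; rewrite /G update_id; lra.
Qed.

(** Submodularity is the rectangle inequality for each pair potential.  For
    the touching property, a strict inequality at a neighbour of a common site
    would make the rectangle inequality of the nearest-neighbour pair strict
    to first order; so agreement spreads to both neighbours. *)
Lemma weak_twist_lattice_energy : lattice_energy S.
Proof.
have [f [SE f_periodic f_rect]] := weak_twist_pairs.
have kappa_ge0 j : 0 <= kappa j by rewrite /kappa; case: ifP => // _; exact: ltW.
have f_rect0 j a a' b b' : a <= a' -> b <= b' ->
    f j (pt2 a' b') + f j (pt2 a b) <= f j (pt2 a b') + f j (pt2 a' b).
  move=> aa bb; apply: le_trans (f_rect j _ _ _ _ aa bb).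
  by rewrite lerDl !mulr_ge0 ?subr_ge0.
have sub i (x y : zseq R) :
    shiftS S i (seq_min x y) + shiftS S i (seq_max x y) <=
    shiftS S i x + shiftS S i y.
  rewrite !SE -!big_split /=; apply: ler_sum => j _.
  rewrite /seq_min /seq_max.
  case: (lerP (x i) (y i)) => h1; case: (lerP (x (i + j.+1%:Z)) (y (i + j.+1%:Z))) => h2.
  - exact: lexx.
  - by have := f_rect0 j _ _ _ _ h1 (ltW h2); lra.
  - by have := f_rect0 j _ _ _ _ (ltW h1) h2; lra.
  - by lra.
split=> //.
- by have [[cS _ _ _ _] _] := hS.
- move=> xi.
  (* z extends the tuple xi to a sequence; only its values at 0, ..., r matter *)
  pose z : zseq R := fun k => xi ord0 (inord `|k|%N).
  have zE : \row_(k < r.+1) z (0 + (k : nat)%:Z) = xi.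
    by apply/rowP => k; rewrite mxE /z add0r absz_nat inord_val.
  have := SE 0 (fun k => z k + 1); rewrite /shiftS.
  have -> : \row_(k < r.+1) (z (0 + (k : nat)%:Z) + 1) = xi + const_mx 1.
    by rewrite -[in RHS]zE; apply/rowP => k; rewrite !mxE.
  move=> ->; rewrite -[in RHS]zE; have := SE 0 z; rewrite /shiftS => ->.
  by apply: eq_bigr => j _; rewrite f_periodic.
move=> x y i gx gy xy xyi.
pose j0 : 'I_r := Ordinal hr.
have diff (k i' : int) (t c : R) : x i' = y i' -> x i' < t ->
    (f j0 (pt2 (update y i' t k) (update y i' t (k + 1))) +
     f j0 (pt2 (x k) (x (k + 1))) + c <=
     f j0 (pt2 (update x i' t k) (update x i' t (k + 1))) +
     f j0 (pt2 (y k) (y (k + 1)))) ->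
    shiftS S k (update y i' t) + shiftS S k x + c <=
    shiftS S k (update x i' t) + shiftS S k y.
  move=> xyi' xt hc; rewrite !SE -!big_split /=.
  rewrite (bigD1 j0) //= [leRHS](bigD1 j0) //= [leLHS]addrAC; apply: lerD => //.
  apply: ler_sum => j _; rewrite /update.
  case: eqP => [->|_]; case: eqP => [ji|_]; rewrite ?lexx //.
  - by lia.
  - by rewrite -xyi'; have := f_rect0 j _ _ _ _ (ltW xt) (xy (i' + j.+1%:Z)); lra.
  - by rewrite ji -xyi'; have := f_rect0 j _ _ _ _ (xy k) (ltW xt); lra.
  - by rewrite addrC.
have right i' : x i' = y i' -> x (i' + 1) = y (i' + 1).
  move=> xyi'; apply/eqP; rewrite eq_le xy /= leNgt; apply/negP => lt1.
  pose eta := lambda * (y (i' + 1) - x (i' + 1)).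
  apply: (@touching_contradiction i' i' x y eta) => //; first by lia.
    by rewrite /eta mulr_gt0 // subr_gt0.
  move=> t xt; apply: diff => //; rewrite /update eqxx.
  have -> : (i' + 1 == i') = false by apply/eqP; lia.
  rewrite -xyi'; have := f_rect j0 _ _ _ _ (ltW xt) (ltW lt1).
  by rewrite /kappa /= /eta; lra.
have left i' : x i' = y i' -> x (i' - 1) = y (i' - 1).
  move=> xyi'; apply/eqP; rewrite eq_le xy /= leNgt; apply/negP => lt1.
  pose eta := lambda * (y (i' - 1) - x (i' - 1)).
  apply: (@touching_contradiction (i' - 1) i' x y eta) => //; first by lia.
    by rewrite /eta mulr_gt0 // subr_gt0.
  move=> t xt; apply: diff => //; rewrite /update subrK eqxx.
  have -> : (i' - 1 == i') = false by apply/eqP; lia.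
  rewrite -xyi'; have := f_rect j0 _ _ _ _ (ltW lt1) (ltW xt).
  by rewrite /kappa /= /eta; lra.
have up (n : nat) : x (i + n%:Z) = y (i + n%:Z).
  elim: n => [|n IH]; first by rewrite addr0.
  by have := right _ IH; rewrite (_ : i + n%:Z + 1 = i + n.+1%:Z) //; lia.
have down (n : nat) : x (i - n%:Z) = y (i - n%:Z).
  elim: n => [|n IH]; first by rewrite subr0.
  by have := left _ IH; rewrite (_ : i - n%:Z - 1 = i - n.+1%:Z) //; lia.
apply/funext => k; have [ik|ki] := lerP i k.
  by have := up `|(k - i)%R|%N; rewrite (_ : i + _ = k) //; lia.
by have := down `|(k - i)%R|%N; rewrite (_ : i - _ = k) //; lia.
Qed.

End WeakTwist.

Unset Implicit Arguments.
Set Strict Implicit.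

Theorem theoremA7 (R : realType) (r : nat) (K lambda : R)
    (hr : (1 <= r)%N) (hK : 0 < K) (hlambda : 0 < lambda)
    (S : 'rV[R]_r.+1 -> R) (hS : weak_twist_energy K lambda S)
    (p : nat) (q : int) (hp : (1 <= p)%N)
    (xm xp : zseq R)
    (hxm : pq_minimizers S p q xm) (hxp : pq_minimizers S p q xp)
    (hlt : lt_seq xm xp)
    (hgap : ~ exists y : zseq R,
        [/\ pq_minimizers S p q y, lt_seq xm y & lt_seq y xp]) :
  exists x xbar : zseq R,
    [/\ (BMplus S p q `\` pq_minimizers S p q) x,
        (BMminus S p q `\` pq_minimizers S p q) xbar,
        lim_pinfty (fun n => tau_pow p%:Z q n x) xp /\
        lim_minfty (fun n => tau_pow p%:Z q n xbar) xp &
        lim_minfty (fun n => tau_pow p%:Z q n x) xm /\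
        lim_pinfty (fun n => tau_pow p%:Z q n xbar) xm].
Proof.
have hlat := weak_twist_lattice_energy hr hlambda hS.
have [x [hx x1 x2]] := ascending_heteroclinic hlat hp hxm hxp hlt hgap.
have [xbar [hxbar xbar1 xbar2]] :=
  descending_heteroclinic hlat hp hxm hxp hlt hgap.
by exists x, xbar.
Qed.
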